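(* Let $\mathbb{F}\in\{\mathbb{R},\mathbb{C}\}$, let $H$ be a Hilbert space over $\mathbb{F}$, let $(A,D(A))$ be a self-adjoint operator on $H$, let $E$ be the (unique) projection-valued measure of $A$ from the Borel functional calculus, and let $f\in\mathrm{Reg}_{\mathbb{F}}(\sigma(A))$ be a regulated function. Then $$\sigma(f(A))=\overline{f(\sigma_p(A))\cup\{f(c^-),f(c^+)\mid c\in\sigma(A)\setminus\sigma_p(A)\}}.$$
   Context: Inner products are linear in the first variable. $\sigma_p(A)$ is the point spectrum (set of eigenvalues) of $A$; $f(c^-)$ and $f(c^+)$ are the left and right limits of $f$ at $c$. The operator $A$ may be bounded or unbounded, so $\sigma(A)\subseteq\mathbb{R}$ is compact or merely closed. Regulated functions: a function $f:\sigma(A)\to\mathbb{F}$ is regulated if all its left and right limits exist on $\sigma(A)$. $\mathrm{Reg}_{\mathbb{F}}(\sigma(A))$ is the set of these functions. Measures: $\mu_{x,y}(B)=\langle E(B)x,y\rangle$ for Borel $B\subseteq\sigma(A)$ and $x,y\in H$. HK integral over a compact $K\subseteq\sigma(A)$: a gauge is a function $\gamma:K\to(0,\infty)$. An exhaustive $K$-division is a finite set of reals $p_0<p_1<\dots<p_m$ with $p_0<\min K$ and $\max K<p_m$. Given such a division, a $K$-cell is any set $K\cap J$ with $J$ one of $[p_{i-1},p_i]$, $[p_{i-1},p_i)$, $(p_{i-1},p_i]$, $(p_{i-1},p_i)$. A partition of $K$ is a finite collection of $K$-cells $C_j$ with $\bigcup_jC_j=K$. A tagged partition is a partition together with points $t_j$,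 each sitting in precisely one $K$-cell, $t_j\in C_j$. A gauge-fine tagged partition $\widehat P_\gamma$ is a tagged partition with $C_j\subseteq(t_j-\gamma(t_j),t_j+\gamma(t_j))\cap K$ for all $j$. A function $f$ on $K$ is $\mu_{x,y}$-HK-integrable with integral $\int_Kf\,d\mu_{x,y}$ if $$(\forall\varepsilon>0)(\exists\gamma\text{ a gauge})(\forall x,y\in H)\Big(\exists\int_Kf\,d\mu_{x,y}\in\mathbb{F}\Big)(\forall\text{ gauge-fine tagged partitions }\widehat P_\gamma):\ \Big|\sum_jf(t_j)\mu_{x,y}(C_j)-\int_Kf\,d\mu_{x,y}\Big|<\varepsilon.$$ Operator $f(A)$: if $A$ is bounded, $f(A)\in B(H)$ is the unique bounded operator with $\langle f(A)x,y\rangle=\int_{\sigma(A)}f\,d\mu_{x,y}$ for all $x,y\in H$. If $A$ is unbounded, put $I^n_{x,y}(f)=\int_{\sigma(A)\cap[-n,n]}f\,d\mu_{x,y}$ and $D(f(A))=\{x\in H:\lim_{n\to\infty}I^n_{x,x}(|f|^2)<\infty\}$; then $f(A)$ is the linear operator with domain $D(f(A))$ determined by $\langle f(A)x,y\rangle=\lim_{n\to\infty}I^n_{x,y}(f)$ for all $x\in D(f(A))$, $y\in H$. *)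

(* Defs.v *)
From HB Require Import structures.
From mathcomp Require Import all_boot all_order all_algebra.
From mathcomp Require Import sesquilinear complex.
From mathcomp Require Import all_classical all_reals all_analysis.

Set Implicit Arguments.
Unset Strict Implicit.
Unset Printing Implicit Defensive.

Import Order.TTheory GRing.Theory Num.Theory.
Import numFieldNormedType.Exports.

Local Open Scope classical_set_scope.
Local Open Scope ring_scope.

Variant scalar_kind := RealScalars | ComplexScalars.

Definition scalar_field (R : realType) (k : scalar_kind) : numFieldType :=
  match k with
  | RealScalars => R
  | ComplexScalars => R[i]%C
  end.

Definition of_real (R : realType) (k : scalar_kind) : R -> scalar_field R k :=
  match k with
  | RealScalars => fun x => x
  | ComplexScalars => fun x => real_complex R x
  end.
Arguments of_real {R} k _.

Definition real_part (R : realType) (k : scalar_kind) : scalar_field R k -> R :=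
  match k with
  | RealScalars => fun z => z
  | ComplexScalars => fun z => complex.Re z
  end.
Arguments real_part {R} k _.

Definition scalar_conj (R : realType) (k : scalar_kind) :
    scalar_field R k -> scalar_field R k :=
  match k with
  | RealScalars => fun z => z
  | ComplexScalars => fun z => conjc z
  end.
Arguments scalar_conj R k _ : clear implicits.

Section Operators.
Context {R : realType} {k : scalar_kind}.
Local Notation F := (scalar_field R k).
Context {H : completeNormedModType F}.

(* A linear operator defined on a linear subspace [dom]; the values of the
   underlying function outside [dom] carry no information. *)
Record operator := Operator {
  dom : set H;
  op_fun :> H -> H;
  dom0 : dom 0;
  dom_linear : forall (a : F) x y, dom x -> dom y -> dom (a *: x + y);
  op_linear : forall (a : F) x y, dom x -> dom y ->
    op_fun (a *: x + y) = a *: op_fun x + op_fun y }.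

Definition bounded_operator (T : operator) : Prop :=
  dom T = setT /\ exists M : F, forall x, `|T x| <= M * `|x|.

Definition resolvent_set (T : operator) : set F :=
  [set l | exists S : {linear H -> H},
    [/\ continuous S,
        (forall y, dom T (S y) /\ T (S y) - l *: S y = y) &
        (forall x, dom T x -> S (T x - l *: x) = x)]].

Definition spectrum (T : operator) : set F := ~` resolvent_set T.

Definition point_spectrum (T : operator) : set F :=
  [set l | exists x, [/\ dom T x, x != 0 & T x = l *: x]].

(* A self-adjoint operator has real spectrum, so nothing is lost in passing to
   the following subsets of the real line. *)
Definition rspectrum (T : operator) : set R := of_real k @^-1` spectrum T.

Definition rpoint_spectrum (T : operator) : set R :=
  of_real k @^-1` point_spectrum T.

(* [ip] is linear in its first argument, see [hermitian] in [sesquilinear]. *)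
Context (ip : {dot H for scalar_conj R k}).

Definition is_hilbert : Prop := forall x : H, `|x| ^+ 2 = ip x x.

(* A is densely defined and has the same graph as its adjoint. *)
Definition self_adjoint (A : operator) : Prop :=
  dense (dom A) /\
  forall y z, (dom A y /\ A y = z) <->
              (forall x, dom A x -> ip (A x) y = ip x z).

Definition orthogonal_projection (P : {linear H -> H}) : Prop :=
  (forall x, P (P x) = P x) /\ (forall x y, ip (P x) y = ip x (P y)).

(* Only the values of E on Borel subsets of S matter. *)
Record projection_valued_measure (S : set R) (E : set R -> {linear H -> H}) :
    Prop := {
  pvm_projection : forall B, measurable B -> B `<=` S ->
    orthogonal_projection (E B);
  pvm_set0 : forall x, E set0 x = 0;
  pvm_total : forall x, E S x = x;
  pvm_setI : forall B C, measurable B -> B `<=` S ->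
    measurable C -> C `<=` S -> forall x, E (B `&` C) x = E B (E C x);
  pvm_sigma_additive : forall B : (set R)^nat,
    (forall i, measurable (B i)) -> (forall i, B i `<=` S) ->
    trivIset setT B -> forall x,
    (fun n => \sum_(i < n) E (B i) x) @ \oo --> E (\bigcup_i B i) x }.

Definition spectral_mu (E : set R -> {linear H -> H}) (x y : H) (B : set R) : F :=
  ip (E B x) y.

(* m is the positive Borel measure mu_(x, x), extended by 0 from S to the
   line. *)
Definition is_diag_measure (S : set R) (E : set R -> {linear H -> H}) (x : H)
    (m : {measure set (measurableTypeR R) -> \bar R}) : Prop :=
  forall B : set R, measurable B ->
    m B = (real_part k (spectral_mu E x x (B `&` S)))%:E.

(* E is the projection-valued measure of A: A is the (Lebesgue) integral of the
   identity function against E, on its maximal domain. *)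
Definition spectral_measure_of (A : operator) (E : set R -> {linear H -> H}) :
    Prop :=
  projection_valued_measure (rspectrum A) E /\
  forall x, exists m : {measure set (measurableTypeR R) -> \bar R},
    [/\ is_diag_measure (rspectrum A) E x m,
        dom A x <-> (\int[m]_(t in rspectrum A) (t ^+ 2)%:E < +oo)%E &
        dom A x -> ip (A x) x = of_real k (\int[m]_(t in rspectrum A) t)].

Definition gauge (K : set R) (gamma : R -> R) : Prop :=
  forall t, K t -> 0 < gamma t.

Definition exhaustive_division (K : set R) (p : seq R) : Prop :=
  [/\ (0 < size p)%N, sorted <%R p &
      forall t, K t -> head 0 p < t < last 0 p].

(* The two booleans choose, for each endpoint, whether it belongs to J. *)
Definition cell (K : set R) (p : seq R) (C : set R) : Prop :=
  exists (i : nat) (b1 b2 : bool), (i.+1 < size p)%N /\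
    C = K `&` [set` Interval (BSide b1 p`_i) (BSide b2 p`_i.+1)].

(* Cells are pairwise disjoint, as usual for a partition: a collection of
   overlapping cells would count some of the mass more than once. *)
Definition tagged_partition (K : set R) (n : nat)
    (t : 'I_n -> R) (C : 'I_n -> set R) : Prop :=
  [/\ exists2 p, exhaustive_division K p & forall j, cell K p (C j),
      \bigcup_j C j = K,
      trivIset setT C &
      forall j i, C i (t j) <-> i = j].

Definition gauge_fine (gamma : R -> R) (n : nat)
    (t : 'I_n -> R) (C : 'I_n -> set R) : Prop :=
  forall j, C j `<=` [set s | t j - gamma (t j) < s < t j + gamma (t j)].

(* f is HK-integrable over K with respect to mu, with integral I. When
   mu = spectral_mu E x y the gauge may depend on x and y. With a gauge common
   to all x, y in H, homogeneity of mu in x would force all gauge-fine sums to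
   be equal, so that not even the identity function would be integrable in
   general. *)
Definition HK_integral (K : set R) (mu : set R -> F) (f : R -> F) (I : F) :
    Prop :=
  forall e : R, 0 < e -> exists2 gamma, gauge K gamma &
    forall (n : nat) (t : 'I_n -> R) (C : 'I_n -> set R),
      tagged_partition K t C -> gauge_fine gamma t C ->
      `|\sum_(j < n) f (t j) * mu (C j) - I| < of_real k e.

(* u n is the integral over the part of S in [-n, n]. *)
Definition HK_truncations (S : set R) (mu : set R -> F) (f : R -> F)
    (u : F^nat) : Prop :=
  forall n : nat, HK_integral (S `&` `[- n%:R, n%:R]) mu f (u n).

Definition fcalc_domain (A : operator) (E : set R -> {linear H -> H})
    (f : R -> F) : set H :=
  [set x | exists2 u : F^nat,
     HK_truncations (rspectrum A) (spectral_mu E x x)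
       (fun t => `|f t| ^+ 2) u & cvgn u].

(* T is the operator f(A). *)
Definition is_fcalc (A : operator) (E : set R -> {linear H -> H}) (f : R -> F)
    (T : operator) : Prop :=
  (bounded_operator A ->
     bounded_operator T /\
     forall x y, HK_integral (rspectrum A) (spectral_mu E x y) f (ip (T x) y)) /\
  (~ bounded_operator A ->
     dom T = fcalc_domain A E f /\
     forall x y, dom T x -> exists2 u : F^nat,
       HK_truncations (rspectrum A) (spectral_mu E x y) f u &
       u @ \oo --> ip (T x) y).

End Operators.
Arguments operator {R k} H.

Section Regulated.
Context {R : realType} {k : scalar_kind}.
Local Notation F := (scalar_field R k).

(* Functions on S are represented by functions on the line; only their values
   on S matter. The existence of the left limit at c is no condition when S
   does not accumulate at c from the left, and likewise on the right. *)
Definition regulated (S : set R) (f : R -> F) : Prop :=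
  forall c, S c -> cvg (f @ within S c^'-) /\ cvg (f @ within S c^'+).

(* l = f(c^-), resp. l = f(c^+); these are only meaningful when c is a limit
   point of S from the left, resp. from the right. *)
Definition left_limit (S : set R) (f : R -> F) (c : R) (l : F) : Prop :=
  limit_point (S `&` `]-oo, c[) c /\ f @ within S c^'- --> l.

Definition right_limit (S : set R) (f : R -> F) (c : R) (l : F) : Prop :=
  limit_point (S `&` `]c, +oo[) c /\ f @ within S c^'+ --> l.

Definition one_sided_limits (S D : set R) (f : R -> F) : set F :=
  [set l | exists2 c, D c & left_limit S f c l \/ right_limit S f c l].

End Regulated.

(* Main.v *)
From HB Require Import structures.
Require Import Defs.
From mathcomp Require Import all_boot all_order all_algebra.
From mathcomp Require Import sesquilinear complex.
From mathcomp Require Import all_classical all_reals all_analysis.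
From mathcomp Require Import measurable_realfun.
From mathcomp Require Import ring lra.

Set Implicit Arguments.
Unset Strict Implicit.
Unset Printing Implicit Defensive.

Import Order.TTheory GRing.Theory Num.Theory.
Import numFieldNormedType.Exports.
Local Open Scope classical_set_scope.
Local Open Scope ring_scope.

(* Step functions approximate f uniformly on each compact part of sigma(A), so f(A) acts on the
   range of E(J), for J a bounded interval, like a scalar up to the oscillation of f on J. As
   E(J) <> 0 whenever J is open and meets sigma(A), and E({c}) <> 0 exactly when c is an
   eigenvalue, every f(c) with c in sigma_p(A) and every one-sided limit of f is an approximate
   eigenvalue of f(A). Conversely, if l has positive distance to these values, then f is
   approximated by step functions whose values on the pieces of nonzero E-measure stay away
   from l, so f(A) - l is bounded below with dense range, hence invertible. *)

(** The definition determines f(A) only weakly, through scalar HK integrals, and by separate clauses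
    for bounded and unbounded A. The proof replaces these by norm-convergent integrals D_n(x) of f
    over the part of sigma(A) in [-n,n] against the vector measure B |-> E(B)x. Uniqueness of HK
    integrals, which rests on Cousin's lemma, identifies them with the given data and leaves the
    same two facts in both cases: x lies in the domain of f(A) as soon as the D_n(x) are bounded in
    n, and E([-n,n]) f(A)x = D_n(x) for x in that domain. All that is proved about f(A) follows from
    these two. Likewise, E is tied to A only through the domain and the quadratic form of A, so the
    vanishing of the cross terms between E(B)x and its complementary part has to be derived from
    additivity of the integral. For c outside sigma_p(A) only one-sided limits count: E({c}) = 0
    makes the value f(c) invisible and also forces c to be an accumulation point of sigma(A). *)

(** * Real and complex scalars treated uniformly *)

Section Scalars.
Context {R : realType} {k : scalar_kind}.
Local Notation F := (scalar_field R k).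
Local Notation "a %:F" := (of_real k a).

Lemma of_realK (a : R) : real_part k a%:F = a.
Proof. by case: k. Qed.

Lemma of_realD (a b : R) : (a + b)%:F = a%:F + b%:F.
Proof. by case: k => //=; rewrite rmorphD. Qed.

Lemma of_realN (a : R) : (- a)%:F = - a%:F.
Proof. by case: k => //=; rewrite rmorphN. Qed.

Lemma of_realB (a b : R) : (a - b)%:F = a%:F - b%:F.
Proof. by rewrite of_realD of_realN. Qed.

Lemma of_realM (a b : R) : (a * b)%:F = a%:F * b%:F.
Proof. by case: k => //=; rewrite rmorphM. Qed.

Lemma of_real_sqr (a : R) : (a ^+ 2)%:F = a%:F ^+ 2.
Proof. by rewrite !expr2 of_realM. Qed.

Lemma of_real0 : (0 : R)%:F = 0.
Proof. by case: k. Qed.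

Lemma of_real1 : (1 : R)%:F = 1.
Proof. by case: k. Qed.

Lemma of_real_le (a b : R) : (a%:F <= b%:F) = (a <= b).
Proof. by case: k => //=; rewrite lecR. Qed.

Lemma of_real_lt (a b : R) : (a%:F < b%:F) = (a < b).
Proof. by case: k => //=; rewrite ltcR. Qed.

Lemma ger0_of_real (z : F) : 0 <= z -> (real_part k z)%:F = z.
Proof.
move: z; case: k => //= -[a b]; rewrite lecE /= => /andP[/eqP b0 _].
by rewrite /real_complex_def b0.
Qed.

Lemma real_partD (z w : F) : real_part k (z + w) = real_part k z + real_part k w.
Proof. by move: z w; case: k => //= -[? ?] [? ?]. Qed.

Lemma real_partN (z : F) : real_part k (- z) = - real_part k z.
Proof. by move: z; case: k => //= -[? ?]. Qed.

Lemma real_partM (a : R) (z : F) : real_part k (a%:F * z) = a * real_part k z.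
Proof. by move: z; case: k => //= -[? ?] /=; rewrite mul0r subr0. Qed.

Lemma real_part_conj (z : F) : real_part k (scalar_conj R k z) = real_part k z.
Proof. by move: z; case: k => //= -[? ?]. Qed.

Lemma scalar_conjK (z : F) : scalar_conj R k (scalar_conj R k z) = z.
Proof. by move: z; case: k => //= -[? ?] /=; rewrite opprK. Qed.

Lemma mul_scalar_conj (z : F) : scalar_conj R k z * z = `|z| ^+ 2.
Proof.
move: z; case: k => /= z; first by rewrite real_normK ?num_real.
by rewrite mulrC sqr_normc.
Qed.

(** Norms take values in F, which is only partially ordered when it is complex; moving them to R
    gives a total order and makes [lra] and [nra] applicable. *)
Definition rnorm (V : normedZmodType F) (x : V) : R := real_part k `|x|.

Lemma rnormE (V : normedZmodType F) (x : V) : (rnorm x)%:F = `|x|.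
Proof. exact/ger0_of_real/normr_ge0. Qed.

Lemma rnorm_ge0 (V : normedZmodType F) (x : V) : 0 <= rnorm x.
Proof. by rewrite -of_real_le of_real0 rnormE. Qed.

Lemma rnorm0 (V : normedZmodType F) : rnorm (0 : V) = 0.
Proof. by rewrite /rnorm normr0 -of_real0 of_realK. Qed.

Lemma rnorm0_eq0 (V : normedZmodType F) (x : V) : rnorm x = 0 -> x = 0.
Proof. by move=> x0; apply/normr0_eq0; rewrite -rnormE x0 of_real0. Qed.

Lemma rnorm_le0 (V : normedZmodType F) (x : V) : rnorm x <= 0 -> x = 0.
Proof. by move=> x0; apply/rnorm0_eq0/le_anti; rewrite x0 rnorm_ge0. Qed.

Lemma rnormN (V : normedZmodType F) (x : V) : rnorm (- x) = rnorm x.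
Proof. by rewrite /rnorm normrN. Qed.

Lemma rnormBC (V : normedZmodType F) (x y : V) : rnorm (x - y) = rnorm (y - x).
Proof. by rewrite -rnormN opprB. Qed.

Lemma rnormD (V : normedZmodType F) (x y : V) : rnorm (x + y) <= rnorm x + rnorm y.
Proof. by rewrite -of_real_le of_realD !rnormE ler_normD. Qed.

Lemma rnorm_tri (V : normedZmodType F) (y x z : V) :
  rnorm (x - z) <= rnorm (x - y) + rnorm (y - z).
Proof. by rewrite -[x - z](subrKA y) rnormD. Qed.

Lemma rnormZ (V : normedModType F) (a : F) (x : V) : rnorm (a *: x) = rnorm a * rnorm x.
Proof. by rewrite {1}/rnorm normrZ -!rnormE -of_realM of_realK. Qed.

Lemma rnormM (a b : F) : rnorm (a * b) = rnorm a * rnorm b.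
Proof. by rewrite {1}/rnorm normrM -!rnormE -of_realM of_realK. Qed.

Lemma rnormV (a : F) : rnorm a^-1 = (rnorm a)^-1.
Proof.
have [->|a0] := eqVneq a 0; first by rewrite invr0 rnorm0 invr0.
have ra : rnorm a != 0 by apply: contra_neq a0 => /rnorm0_eq0.
apply: (mulfI ra); rewrite -rnormM !mulfV // /rnorm normr1.
by rewrite -[RHS]of_realK of_real1.
Qed.

Lemma rnorm_real (a : R) : rnorm a%:F = `|a|.
Proof.
rewrite /rnorm; case: k => //=; rewrite /Num.norm/= expr0n addr0.
by rewrite sqrtr_sqr.
Qed.

Lemma rnorm_lt (V : normedZmodType F) (x : V) (e : R) : (rnorm x < e) = (`|x| < e%:F).
Proof. by rewrite -rnormE of_real_lt. Qed.

(** The multiplier conj(z - w) turns the hypothesis into |z - w|^2 = 0. *)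
Lemma real_part_inj (z w : F) :
  (forall a : F, real_part k (a * z) = real_part k (a * w)) -> z = w.
Proof.
move=> zw; apply/eqP; rewrite -subr_eq0; apply/eqP.
have : real_part k (scalar_conj R k (z - w) * (z - w)) = 0.
  by rewrite mulrBr real_partD real_partN zw subrr.
rewrite mul_scalar_conj -rnormE expr2 real_partM of_realK => /eqP.
by rewrite mulf_eq0 orbb => /eqP /rnorm0_eq0.
Qed.

Lemma cvg_rnormP (V : normedModType F) (u : nat -> V) (v : V) :
  (u @ \oo --> v) <->
  (forall e : R, 0 < e -> \forall n \near \oo, rnorm (u n - v) < e).
Proof.
split=> [uv e e0|uv].
  move/cvgrPdist_lt: uv => /(_ e%:F); rewrite -of_real0 of_real_lt => /(_ e0).
  by apply: filterS => n; rewrite -rnorm_lt rnormBC.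
apply/cvgrPdist_lt => e e0; have e0' := ger0_of_real (ltW e0).
have : 0 < real_part k e by rewrite -of_real_lt e0' of_real0.
by move/uv; apply: filterS => n; rewrite rnormBC rnorm_lt e0'.
Qed.

Lemma cvg_rnorm (V : normedModType F) (u : nat -> V) (v : V) :
  u @ \oo --> v -> rnorm (u n) @[n --> \oo] --> rnorm v.
Proof.
move=> /cvg_rnormP uv; apply/cvgrPdist_lt => e e0.
apply: filterS (uv _ e0) => n; apply: le_lt_trans.
rewrite ler_norml; apply/andP; split.
  by have := rnormD (u n - v) v; rewrite subrK; lra.
by have := rnormD (v - u n) (u n); rewrite subrK rnormBC; lra.
Qed.

Lemma cauchy_rnorm_cvg (V : completeNormedModType F) (u : nat -> V) :
  (forall e : R, 0 < e -> \forall n \near \oo, forall m, (n <= m)%N -> rnorm (u m - u n) < e) ->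
  exists v : V, u @ \oo --> v.
Proof.
move=> cu; suff : cvgn u by move=> uv; exists (limn u).
apply/cauchy_cvgP/cauchy_exP => e e0.
have e0' := ger0_of_real (ltW e0).
have : 0 < real_part k e by rewrite -of_real_lt e0' of_real0.
move/cu => [n _ /(_ n (leqnn n))] un; exists (u n); exists n => // m /= nm.
by rewrite -ball_normE /= -e0' -rnorm_lt rnormBC un.
Qed.

End Scalars.
Arguments rnorm {R k V} x.

(** * Hilbert space geometry and an invertibility criterion for closed operators *)

Section Hilbert.
Context {R : realType} {k : scalar_kind}.
Local Notation F := (scalar_field R k).
Local Notation "a %:F" := (of_real k a).
Context {H : completeNormedModType F} (ip : {dot H for scalar_conj R k}).

(** The underlying real inner product: it is symmetric and induces the same norm, so both scalar
    fields share one real argument. [eq_rip_ip] returns to F-valued identities. *)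
Definition rip (x y : H) : R := real_part k (ip x y).

Lemma ipC x y : ip x y = scalar_conj R k (ip y x).
Proof. by have := @hermitian_subproof _ _ _ _ ip x y; rewrite mul1r. Qed.

Lemma ripC x y : rip x y = rip y x.
Proof. by rewrite /rip ipC real_part_conj. Qed.

Lemma ripDl x y z : rip (x + y) z = rip x z + rip y z.
Proof. by rewrite /rip linearDl real_partD. Qed.

Lemma ripDr x y z : rip x (y + z) = rip x y + rip x z.
Proof. by rewrite ripC ripDl !(ripC x). Qed.

Lemma ripNl x z : rip (- x) z = - rip x z.
Proof. by rewrite /rip linearNl real_partN. Qed.

Lemma ripNr x z : rip x (- z) = - rip x z.
Proof. by rewrite ripC ripNl ripC. Qed.

Lemma ripBl x y z : rip (x - y) z = rip x z - rip y z.
Proof. by rewrite ripDl ripNl. Qed.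

Lemma ripZl (a : R) x y : rip (a%:F *: x) y = a * rip x y.
Proof. by rewrite /rip linearZl_LR /= real_partM. Qed.

Lemma ripZr (a : R) x y : rip x (a%:F *: y) = a * rip x y.
Proof. by rewrite ripC ripZl ripC. Qed.

Definition ripE := (ripDl, ripDr, ripNl, ripNr, ripZl, ripZr).

Lemma rip0l x : rip 0 x = 0.
Proof. by rewrite -(subrr x) ripBl subrr. Qed.

Lemma rip0r x : rip x 0 = 0.
Proof. by rewrite ripC rip0l. Qed.

Lemma eq_rip_ip x y z w : (forall a : F, rip (a *: x) y = rip (a *: z) w) -> ip x y = ip z w.
Proof. by move=> xy; apply: real_part_inj => a; have := xy a; rewrite /rip !linearZl_LR. Qed.

Hypothesis hilbertH : is_hilbert ip.

Lemma rnorm_sqr x : rnorm x ^+ 2 = rip x x.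
Proof. by rewrite /rip -hilbertH -rnormE -of_real_sqr of_realK. Qed.

Lemma rnorm_sqrD x y : rnorm (x + y) ^+ 2 = rnorm x ^+ 2 + rnorm y ^+ 2 + 2 * rip x y.
Proof. by rewrite !rnorm_sqr ripDl !ripDr (ripC y x); ring. Qed.

Lemma rip_orthogonal_eq0 x : (forall y, rip x y = 0) -> x = 0.
Proof. by move/(_ x); rewrite -rnorm_sqr => /eqP; rewrite sqrf_eq0 => /eqP /rnorm0_eq0. Qed.

Lemma rip_le x y : `|rip x y| <= rnorm x * rnorm y.
Proof.
have [y0|y0] := eqVneq (rnorm y) 0.
  by rewrite (rnorm0_eq0 y0) rip0r normr0 rnorm0 mulr0.
have yp : 0 < rnorm y ^+ 2 by rewrite exprn_gt0 // lt_neqAle eq_sym y0 rnorm_ge0.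
rewrite -ler_sqr ?nnegrE ?mulr_ge0 ?rnorm_ge0 // real_normK ?num_real //.
(* Cauchy-Schwarz comes from expanding the squared norm of |y|^2 x - <x,y> y, which avoids
   division. *)
set a := rnorm y ^+ 2 in yp *.
have := sqr_ge0 (rnorm (a%:F *: x - (rip x y)%:F *: y)).
rewrite rnorm_sqr !ripE (ripC y x) -!rnorm_sqr -/a => h.
rewrite exprMn -/a -subr_ge0 -(pmulr_rge0 _ yp); apply: le_trans h _.
by rewrite le_eqVlt; apply/orP; left; apply/eqP; ring.
Qed.

Lemma rip_ler x y : rip x y <= rnorm x * rnorm y.
Proof. exact: le_trans (ler_norm _) (rip_le x y). Qed.

(** Multiplying x by the conjugate of <x,y> makes the inner product the real number |<x,y>|^2, to
    which the real Cauchy-Schwarz inequality applies. *)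
Lemma rnorm_ip x y : rnorm (ip x y) <= rnorm x * rnorm y.
Proof.
have [z0|z0] := eqVneq (rnorm (ip x y)) 0; first by rewrite z0 mulr_ge0 ?rnorm_ge0.
have zp : 0 < rnorm (ip x y) by rewrite lt_neqAle eq_sym z0 rnorm_ge0.
have conjE (z : F) : rnorm (scalar_conj R k z) = rnorm z.
  apply/eqP; rewrite -(@eqrXn2 _ 2) ?rnorm_ge0 //; apply/eqP.
  have sq (w : F) : rnorm w ^+ 2 = real_part k (scalar_conj R k w * w).
    by rewrite mul_scalar_conj -rnormE -of_real_sqr of_realK.
  by rewrite !sq scalar_conjK mulrC.
have := rip_ler (scalar_conj R k (ip x y) *: x) y.
rewrite {1}/rip linearZl_LR /= mul_scalar_conj -rnormE -of_real_sqr of_realK rnormZ.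
by rewrite conjE -mulrA ler_pM2l.
Qed.

Lemma cvg_rip (u : nat -> H) v y : u @ \oo --> v -> rip (u n) y @[n --> \oo] --> rip v y.
Proof.
move=> /cvg_rnormP uv; apply/cvgrPdist_lt => e e0.
have y1 : 0 < rnorm y + 1 by have := rnorm_ge0 y; lra.
apply: filterS (uv _ (divr_gt0 e0 y1)) => n un.
rewrite -ripBl; apply: le_lt_trans (rip_le _ _) _; rewrite rnormBC.
have := rnorm_ge0 y; have := rnorm_ge0 (u n - v).
rewrite ltr_pdivlMr // in un; nra.
Qed.

Lemma rip_limit_eq (u w : nat -> H) v y x z :
  u @ \oo --> v -> w @ \oo --> x -> (forall n, rip (u n) y = rip (w n) z) -> rip v y = rip x z.
Proof.
move=> uv wx e.
rewrite -(cvg_lim (@Rhausdorff R) (cvg_rip (y := y) uv)).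
rewrite -(cvg_lim (@Rhausdorff R) (cvg_rip (y := z) wx)).
by under eq_fun do rewrite e.
Qed.

(* The nearest point of V to y: a minimising sequence is Cauchy by the parallelogram law. *)
Lemma closed_subspace_full (V : set H) :
  V 0 -> (forall (a : F) x y, V x -> V y -> V (a *: x + y)) ->
  (forall u x, (forall n, V (u n)) -> u @ \oo --> x -> V x) ->
  (forall y, (forall v, V v -> rip v y = 0) -> y = 0) ->
  forall y, V y.
Proof.
move=> V0 Vlin Vcl Vorth y.
pose D := [set rnorm (y - v) ^+ 2 | v in V].
have D0 : D !=set0 by exists (rnorm (y - 0) ^+ 2); exists 0.
have Dlb : has_lbound D by exists 0 => _ [v _ <-]; exact: sqr_ge0.
have dle v : V v -> inf D <= rnorm (y - v) ^+ 2 by move=> Vv; apply: ge_inf => //; exists v.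
have /choice[u uP] n : exists v, V v /\ rnorm (y - v) ^+ 2 < inf D + n.+1%:R^-1.
  have n0 : 0 < n.+1%:R^-1 :> R by rewrite invr_gt0.
  have [_ [v Vv <-] h] := inf_adherent n0 (conj D0 Dlb).
  by exists v.
(* The midpoint w of u_n and u_m lies in V, so its squared distance to y is at least [inf D]; the
   parallelogram law then bounds |u_m - u_n|. *)
have par n m : rnorm (u m - u n) ^+ 2 <= 2 * n.+1%:R^-1 + 2 * m.+1%:R^-1.
  have [[Vn hn] [Vm hm]] := (uP n, uP m).
  pose w := (2^-1 : R)%:F *: (u n + u m).
  have Vw : V w.
    rewrite -[w]addr0; apply: (Vlin) => //.
    by rewrite -[u n]scale1r; apply: (Vlin).
  have : rnorm (u m - u n) ^+ 2 =
      2 * rnorm (y - u n) ^+ 2 + 2 * rnorm (y - u m) ^+ 2 - 4 * rnorm (y - w) ^+ 2.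
    rewrite /w !rnorm_sqr !ripE.
    by rewrite (ripC (u n) (u m)) (ripC (u n) y) (ripC (u m) y); field.
  move=> ->; have := dle _ Vw; move: hn hm.
  by move: n.+1%:R^-1 m.+1%:R^-1 => a b; lra.
have [v uv] : exists v : H, u @ \oo --> v.
  apply: cauchy_rnorm_cvg => e e0.
  have e4 : 0 < e ^+ 2 / 4 by rewrite divr_gt0 ?exprn_gt0.
  have := near_infty_natSinv_lt (PosNum e4).
  apply: filterS => /= n hn m nm; rewrite -(@ltr_pXn2r _ 2) ?nnegrE ?rnorm_ge0 ?ltW //.
  have mn : m.+1%:R^-1 <= n.+1%:R^-1 :> R by rewrite lef_pV2 ?posrE // ler_nat.
  apply: le_lt_trans (par n m) _.
  by move: mn hn; move: n.+1%:R^-1 m.+1%:R^-1 => a b; lra.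
have Vv : V v by apply: Vcl uv => n; case: (uP n).
have vmin : rnorm (y - v) ^+ 2 <= inf D.
  have yu : (y - u n) @[n --> \oo] --> y - v by apply: cvgB => //; exact: cvg_cst.
  have h : rnorm (y - u n) * rnorm (y - u n) @[n --> \oo] --> rnorm (y - v) * rnorm (y - v).
    by apply: cvgM; exact: cvg_rnorm.
  have h' : inf D + harmonic n @[n --> \oo] --> inf D + 0.
    by apply: cvgD; [exact: cvg_cst | exact: cvg_harmonic].
  rewrite -[inf D]addr0; apply: ler_cvg_to h h' _.
  by exists 0%N => // n _ /=; rewrite -expr2 ltW //; case: (uP n).
have orth w : V w -> rip (y - v) w = 0.
  move=> Vw; apply/eqP; rewrite -sqrf_eq0; apply/eqP.
  have quad (t : R) : 0 <= t ^+ 2 * rnorm w ^+ 2 - 2 * t * rip (y - v) w.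
    have Vtw : V (t%:F *: w + v) by exact: Vlin.
    have := le_trans vmin (dle _ Vtw).
    rewrite (_ : y - (t%:F *: w + v) = (y - v) + (- t)%:F *: w); last first.
      by rewrite of_realN scaleNr opprD addrAC addrA.
    rewrite [leRHS]rnorm_sqrD ripZr rnormZ rnorm_real normrN exprMn real_normK ?num_real //.
    by lra.
  have [w0|w0] := eqVneq (rnorm w) 0; first by rewrite (rnorm0_eq0 w0) rip0r expr0n.
  have wp : 0 < rnorm w ^+ 2 by rewrite exprn_gt0 // lt_neqAle eq_sym w0 rnorm_ge0.
  (* This is the minimiser of the quadratic polynomial in t; its minimum -b^2/a can only be
     nonnegative if b = 0. *)
  have := quad (rip (y - v) w / rnorm w ^+ 2).
  set a := rnorm w ^+ 2 in wp *; set b := rip _ _.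
  rewrite (_ : _ - _ = - (b ^+ 2 / a)); last by field; rewrite gt_eqF.
  rewrite oppr_ge0 pmulr_lle0 ?invr_gt0 // => h.
  by apply/le_anti; rewrite h sqr_ge0.
have yv0 : y - v = 0 by apply: Vorth => w Vw; rewrite ripC orth.
by rewrite -[y](subrK v) yv0 add0r.
Qed.

Definition closed_graph (T : operator H) := forall u x z,
  (forall n, dom T (u n)) -> u @ \oo --> x -> T (u n) @[n --> \oo] --> z ->
  dom T x /\ T x = z.

(** The lower bound makes T - l injective and turns convergent images into Cauchy preimages; with
    the closed graph the range is closed. A closed range with trivial orthogonal complement is all
    of H, and the inverse has norm at most 1/d. *)
Lemma resolvent_of_bounded_below (T : operator H) (l : F) (d : R) :
  0 < d -> closed_graph T ->
  (forall x, dom T x -> d * rnorm x <= rnorm (T x - l *: x)) ->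
  (forall y, (forall x, dom T x -> rip (T x - l *: x) y = 0) -> y = 0) ->
  resolvent_set T l.
Proof.
move=> d0 Tcl bb orth.
have TB (a : F) x y : dom T x -> dom T y ->
    T (a *: x + y) - l *: (a *: x + y) = a *: (T x - l *: x) + (T y - l *: y).
  move=> dx dy; rewrite op_linear // !scalerDr scalerN !scalerA (mulrC l).
  by rewrite addrACA opprD.
have inj x y : dom T x -> dom T y -> T x - l *: x = T y - l *: y -> x = y.
  move=> dx dy xy; have dxy : dom T (-1 *: y + x) by exact: dom_linear.
  have := bb _ dxy; rewrite TB // xy !scaleN1r addNr rnorm0 pmulr_rle0 // addrC.
  by move/rnorm_le0/eqP; rewrite subr_eq0 => /eqP.
have surj y : exists x, dom T x /\ T x - l *: x = y.
  apply: (@closed_subspace_full [set y | exists x, dom T x /\ T x - l *: x = y]).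
  - exists 0; split; first exact: dom0.
    have := TB (-1) 0 0 (dom0 T) (dom0 T).
    by rewrite !(scaleN1r, addNr, oppr0, addr0, scaler0).
  - move=> a _ _ [x [dx <-]] [x' [dx' <-]]; exists (a *: x + x').
    by split; [exact: dom_linear | rewrite TB].
  - move=> w z /choice[u uP] wz.
    have [x ux] : exists x : H, u @ \oo --> x.
      apply: cauchy_rnorm_cvg => e e0.
      have := cvg_rnormP w z => -[/(_ wz) /(_ (d * e / 2))].
      rewrite !(mulr_gt0, divr_gt0) // => /(_ isT) [n0 _ h] _.
      exists n0 => // n /= n0n m nm.
      have [dm um] := uP m; have [dn un] := uP n.
      have := bb _ (dom_linear (-1) dn dm); rewrite TB // un um !scaleN1r !(addrC (- _)).
      have := h _ n0n; have := h _ (leq_trans n0n nm) => /=.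
      have := rnorm_tri z (w m) (w n); rewrite (rnormBC z) => h1 h2 h3 h4.
      by rewrite -(ltr_pM2l d0); lra.
    have Tu : T (u n) @[n --> \oo] --> z + l *: x.
      rewrite (_ : (fun n => T (u n)) = (fun n => w n + l *: u n)); last first.
        by apply/funext => n; have [_ <-] := uP n; rewrite subrK.
      by apply: cvgD => //; apply: cvgZr.
    have [dx Tx] := Tcl _ _ _ (fun n => (uP n).1) ux Tu.
    by exists x; rewrite Tx addrK.
  - by move=> z zo; apply: orth => x dx; apply: zo; exists x.
have [S SP] := choice surj.
have Slin : linear S.
  move=> a x y; have [dx Sx] := SP x; have [dy Sy] := SP y; have [dxy Sxy] := SP (a *: x + y).
  by apply: inj => //; [exact: dom_linear | rewrite TB // Sx Sy Sxy].
pose mS := GRing.isLinear.Build F H H *:%R S Slin.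
pose S' : {linear H -> H} := HB.pack S mS.
exists S'; split.
- apply/continuousfor0_continuous/cvgrPdist_lt => e e0; have e0' := ger0_of_real (ltW e0).
  have er0 : 0 < real_part k e by rewrite -(@of_real_lt _ k) e0' of_real0.
  apply/nbhs_norm0P; exists (d * real_part k e)%:F => /=.
    by rewrite -(@of_real0 R k) of_real_lt mulr_gt0.
  move=> y; rewrite /= -rnorm_lt => yde; have -> : S 0 = 0 by exact: (linear0 S').
  rewrite sub0r normrN -e0' -rnorm_lt.
  have [dS SE] := SP y; have := bb _ dS; rewrite SE => h.
  by rewrite -(ltr_pM2l d0); exact: le_lt_trans h yde.
- by move=> y; exact: SP.
- by move=> x dx; have [dS SE] := SP (T x - l *: x); exact: inj.
Qed.

Lemma bounded_below_of_resolvent (T : operator H) (l : F) :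
  resolvent_set T l ->
  exists2 d : R, 0 < d & forall x, dom T x -> d * rnorm x <= rnorm (T x - l *: x).
Proof.
move=> [S [Sc _ SK]]; have := Sc 0 => /cvgrPdist_lt /(_ 1 ltr01) /nbhs_norm0P [e /= e0 Se].
have e0' := ger0_of_real (ltW e0); set r := real_part k e in e0'.
have r0 : 0 < r by rewrite -(@of_real_lt _ k) e0' of_real0.
have {}Se y : rnorm y < r -> rnorm (S y) < 1.
  by rewrite !rnorm_lt e0' of_real1 => /Se; rewrite linear0 sub0r normrN.
(* S has norm below 1 on the open ball of radius r; halving r lets the rescaled vector of norm r/2
   lie strictly inside that ball. *)
exists (r / 2) => [|x dx]; first by rewrite divr_gt0.
rewrite -{1}(SK _ dx); set y := T x - l *: x.
have [y0|y0] := eqVneq (rnorm y) 0.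
  by rewrite (rnorm0_eq0 y0) linear0 !rnorm0 mulr0.
have yp : 0 < rnorm y by rewrite lt_neqAle eq_sym y0 rnorm_ge0.
have := Se ((r / 2 / rnorm y)%:F *: y).
rewrite linearZ /= !rnormZ !rnorm_real !gtr0_norm ?divr_gt0 //.
rewrite divfK // => /(_ (ltac:(lra))).
rewrite mulrAC ltr_pdivrMr // mul1r => /ltW; exact.
Qed.

End Hilbert.

(** * Self-adjoint operators: closed graph, real resolvent points, closed spectrum *)

Section SelfAdjoint.
Context {R : realType} {k : scalar_kind}.
Local Notation F := (scalar_field R k).
Local Notation "a %:F" := (of_real k a).
Context {H : completeNormedModType F} (ip : {dot H for scalar_conj R k}).
Hypothesis hilbertH : is_hilbert ip.
Local Notation rip := (rip ip).
Context (A : operator H) (saA : self_adjoint ip A).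

Lemma dense_rip_eq0 (D : set H) (y : H) :
  dense D -> (forall x, D x -> rip x y = 0) -> y = 0.
Proof.
move=> dD Dy; apply/rnorm_le0/ler_addgt0Pr => e e0; rewrite add0r.
have [x [xy Dx]] : (ball y e%:F `&` D) !=set0.
  apply: dD; last exact: ball_open.
  by exists y; apply: ballxx; rewrite -(@of_real0 R k) of_real_lt.
move: xy; rewrite -ball_normE /= -rnorm_lt => yxe.
have [->|y0] := eqVneq (rnorm y) 0; first exact: ltW.
have yp : 0 < rnorm y by rewrite lt_neqAle eq_sym y0 rnorm_ge0.
rewrite -(ler_pM2r yp) -expr2 (rnorm_sqr hilbertH) -{1}[y](subrK x) ripDl (Dy x) // addr0.
by apply: le_trans (rip_ler hilbertH _ _) _; rewrite ler_pM2r // ltW.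
Qed.

Lemma dom_scale (T : operator H) (a : F) x : dom T x -> dom T (a *: x).
Proof. by move=> dx; rewrite -[_ *: _]addr0; apply: dom_linear => //; exact: dom0. Qed.

Lemma dom_add (T : operator H) x y : dom T x -> dom T y -> dom T (x + y).
Proof. by move=> dx dy; rewrite -[x]scale1r; exact: dom_linear. Qed.

Lemma op_add (T : operator H) x y : dom T x -> dom T y -> T (x + y) = T x + T y.
Proof. by move=> dx dy; rewrite -{1}[x]scale1r op_linear // scale1r. Qed.

Lemma op0 (T : operator H) : T 0 = 0.
Proof.
by have := op_add (dom0 T) (dom0 T); rewrite addr0 -{1}[T 0]addr0 => /addrI.
Qed.

Lemma op_scale (T : operator H) (a : F) x : dom T x -> T (a *: x) = a *: T x.
Proof.
by move=> dx; rewrite -[a *: x]addr0 op_linear ?op0 ?addr0 //; exact: dom0.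
Qed.

Lemma self_adjoint_sym x y : dom A x -> dom A y -> ip (A x) y = ip x (A y).
Proof. by move=> dx dy; have [_ /(_ y (A y)) [/(_ (conj dy erefl)) + _]] := saA; exact. Qed.

Lemma self_adjoint_rip x y : dom A x -> dom A y -> rip (A x) y = rip (A y) x.
Proof. by move=> dx dy; rewrite /rip self_adjoint_sym // -[LHS]/(rip _ _) ripC. Qed.

(** A equals its adjoint, and the relation <Ay,x> = <y,z> that defines the graph of the adjoint
    survives limits in (x,z). *)
Lemma self_adjoint_closed_graph : closed_graph A.
Proof.
move=> u x z du ux Auz; have [_ /(_ x z) [_]] := saA; apply => y dy.
apply: eq_rip_ip => a; rewrite -op_scale // !(ripC ip _ x) !(ripC ip _ z).
apply: rip_limit_eq ux Auz _ => // n.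
by rewrite ripC -(self_adjoint_rip (du n)) //; exact: dom_scale.
Qed.

(** A vector orthogonal to the range of A - l lies in the domain of the adjoint, hence is an
    eigenvector of A for the real number l or zero; the lower bound excludes an eigenvector. *)
Lemma self_adjoint_resolvent (l d : R) :
  0 < d -> (forall x, dom A x -> d * rnorm x <= rnorm (A x - l%:F *: x)) ->
  resolvent_set A l%:F.
Proof.
move=> d0 bb; apply: (resolvent_of_bounded_below hilbertH d0 self_adjoint_closed_graph bb).
move=> y yorth; suff [dy Ay] : dom A y /\ A y = l%:F *: y.
  have := bb _ dy; rewrite Ay subrr rnorm0 pmulr_rle0 //; exact: rnorm_le0.
have [_ /(_ y (l%:F *: y)) [_]] := saA; apply => x dx.
apply: eq_rip_ip => a; have := yorth _ (dom_scale a dx).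
by rewrite op_scale // ripBl ripZl (ripC ip _ (l%:F *: y)) ripZl (ripC ip y); lra.
Qed.

(** A lower bound d at t leaves the lower bound d/2 at every s within d/2 of t, so the real
    resolvent points form an open set. *)
Lemma rspectrum_closed : closed (rspectrum A).
Proof.
rewrite /rspectrum /spectrum preimage_setC; apply: open_closedC.
rewrite openE => t /bounded_below_of_resolvent[d d0 bb].
apply/nbhs_ballP; exists (d / 2) => /=; first by rewrite divr_gt0.
move=> s; rewrite -ball_normE /= => ts.
have d2 : 0 < d / 2 by rewrite divr_gt0.
apply: (self_adjoint_resolvent d2) => x dx; have := bb _ dx.
have := rnormD (A x - s%:F *: x) ((s - t)%:F *: x).
rewrite rnormZ rnorm_real distrC of_realB scalerBl addrA subrK.
by have := rnorm_ge0 x; nra.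
Qed.

Lemma rpoint_spectrum_sub : rpoint_spectrum A `<=` rspectrum A.
Proof.
move=> t [x [dx x0 Ax]] /bounded_below_of_resolvent[d d0 /(_ _ dx)].
rewrite Ax subrr rnorm0 pmulr_rle0 // => /rnorm_le0 x00.
by rewrite x00 eqxx in x0.
Qed.

End SelfAdjoint.

(** * Calculus of projection-valued measures *)

Section ProjectionValuedMeasure.
Context {R : realType} {k : scalar_kind}.
Local Notation F := (scalar_field R k).
Context {H : completeNormedModType F} (ip : {dot H for scalar_conj R k}).
Hypothesis hilbertH : is_hilbert ip.
Local Notation rip := (rip ip).

Lemma rip_suml (I : Type) (r : seq I) (P : pred I) (y : I -> H) z :
  rip (\sum_(i <- r | P i) y i) z = \sum_(i <- r | P i) rip (y i) z.
Proof.
by apply: (big_morph (fun u => rip u z)) => [u v|]; [exact: ripDl | exact: rip0l].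
Qed.

Lemma rnorm_sqr_sum (I : finType) (y : I -> H) :
  (forall i j, i != j -> rip (y i) (y j) = 0) ->
  rnorm (\sum_i y i) ^+ 2 = \sum_i rnorm (y i) ^+ 2.
Proof.
move=> orth; rewrite (rnorm_sqr hilbertH) rip_suml; apply: eq_bigr => i _.
rewrite ripC rip_suml (bigD1 i) //= big1 ?addr0 ?(rnorm_sqr hilbertH) // => j ji.
by rewrite orth.
Qed.

Context (S : set R) (mS : measurable S) (E : set R -> {linear H -> H}).
Hypothesis pvmE : projection_valued_measure ip S E.

Definition borel_in (B : set R) := measurable B /\ B `<=` S.

Lemma borel_inS : borel_in S. Proof. by split. Qed.

Lemma borel_in0 : borel_in set0. Proof. by split. Qed.

Lemma borel_inI B C : borel_in B -> measurable C -> borel_in (B `&` C).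
Proof.
move=> [mB BS] mC; split; first exact: measurableI.
exact: subset_trans (@subIsetl _ _ _) BS.
Qed.

Lemma borel_inIl B C : borel_in B -> measurable C -> borel_in (C `&` B).
Proof. by rewrite setIC; exact: borel_inI. Qed.

Lemma borel_inD B C : borel_in B -> measurable C -> borel_in (B `\` C).
Proof. by move=> bB mC; rewrite setDE; apply: borel_inI => //; exact: measurableC. Qed.

Lemma borel_inU B C : borel_in B -> borel_in C -> borel_in (B `|` C).
Proof. by move=> [mB BS] [mC CS]; split; [exact: measurableU | rewrite subUset]. Qed.

Lemma borel_in_bigcup (I : finType) (C : I -> set R) :
  (forall i, borel_in (C i)) -> borel_in (\bigcup_i C i).
Proof.
move=> bC; split; last by move=> t [i _]; exact: (bC i).2.
by apply: fin_bigcup_measurable => [|i _]; [exact: finite_finset | exact: (bC i).1].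
Qed.

Lemma pvm_sym B x y : borel_in B -> rip (E B x) y = rip x (E B y).
Proof. by move=> [mB BS]; rewrite /rip (pvm_projection pvmE mB BS).2. Qed.

Lemma pvm_idem B x : borel_in B -> E B (E B x) = E B x.
Proof. by move=> [mB BS]; exact: (pvm_projection pvmE mB BS).1. Qed.

Lemma pvmI B C x : borel_in B -> borel_in C -> E B (E C x) = E (B `&` C) x.
Proof. by move=> [mB BS] [mC CS]; rewrite (pvm_setI pvmE). Qed.

Lemma pvmC B C x : borel_in B -> borel_in C -> E B (E C x) = E C (E B x).
Proof. by move=> bB bC; rewrite !pvmI // setIC. Qed.

Lemma pvm_subl B C x : borel_in B -> borel_in C -> B `<=` C -> E B (E C x) = E B x.
Proof. by move=> bB bC BC; rewrite pvmI // (setIidl BC). Qed.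

Lemma pvm_subr B C x : borel_in B -> borel_in C -> B `<=` C -> E C (E B x) = E B x.
Proof. by move=> bB bC BC; rewrite pvmC // pvm_subl. Qed.

Lemma pvm_sub_eq0 B C x : borel_in B -> borel_in C -> B `<=` C -> E C x = 0 -> E B x = 0.
Proof. by move=> bB bC BC Cx; rewrite -(pvm_subl _ bB bC BC) Cx linear0. Qed.

Lemma pvm_rnorm_sqr B x : borel_in B -> rnorm (E B x) ^+ 2 = rip (E B x) x.
Proof. by move=> bB; rewrite (rnorm_sqr hilbertH) pvm_sym // pvm_idem // ripC. Qed.

Lemma pvm_rnorm_le B x : borel_in B -> rnorm (E B x) <= rnorm x.
Proof.
move=> bB; have [->|x0] := eqVneq (rnorm (E B x)) 0; first exact: rnorm_ge0.
have xp : 0 < rnorm (E B x) by rewrite lt_neqAle eq_sym x0 rnorm_ge0.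
by rewrite -(ler_pM2l xp) -expr2 pvm_rnorm_sqr //; exact: rip_ler.
Qed.

Lemma pvm_rnorm_sub B C x : borel_in B -> borel_in C -> B `<=` C ->
  rnorm (E B x) <= rnorm (E C x).
Proof. by move=> bB bC BC; rewrite -(pvm_subl x bB bC BC); exact: pvm_rnorm_le. Qed.

Lemma pvmU B C x : borel_in B -> borel_in C -> B `&` C = set0 ->
  E (B `|` C) x = E B x + E C x.
Proof.
move=> [mB BS] [mC CS] BC; rewrite -bigcup2E.
(* Finite additivity is sigma-additivity for the sequence B, C, empty, empty, ..., whose partial
   sums are constant from index 2 on. *)
have := @pvm_sigma_additive _ _ _ _ _ _ pvmE (bigcup2 B C).
move=> /(_ _ _ _ x) h.
have h' : (fun n => \sum_(i < n) E (bigcup2 B C i) x) @ \oo --> E (\bigcup_i bigcup2 B C i) x.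
  by apply: h => [[|[|i]]|[|[|i]]|] //; [exact: measurable0 | rewrite -trivIset_bigcup2].
rewrite -(cvg_lim _ h') //; apply: cvg_lim => //.
apply: cvg_near_cst; exists 2%N => // n /= n2.
rewrite -(subnKC n2) !big_ord_recl big1 ?addr0 // => i _.
by rewrite (pvm_set0 pvmE).
Qed.

Lemma pvm_split B x : borel_in B -> x = E B x + E (S `\` B) x.
Proof.
move=> bB; rewrite -{1}(pvm_total pvmE x) -pvmU ?setDIK //; last first.
  by apply: borel_inD => //; [exact: borel_inS | exact: bB.1].
by rewrite setDUK //; exact: bB.2.
Qed.

Lemma pvm_bigcup (I : finType) (C : I -> set R) x :
  (forall i, borel_in (C i)) -> trivIset setT C ->
  E (\bigcup_i C i) x = \sum_i E (C i) x.
Proof.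
move=> bC tC.
have bigE (s : seq I) : \bigcup_(i in [set` s]) C i = \big[setU/set0]_(i <- s) C i.
  by rewrite bigcup_seq.
have bs (s : seq I) : borel_in (\big[setU/set0]_(i <- s) C i).
  by elim/big_ind: _ => //; [exact: borel_in0 | exact: borel_inU].
suff h (s : seq I) : uniq s ->
    E (\big[setU/set0]_(i <- s) C i) x = \sum_(i <- s) E (C i) x.
  rewrite -h ?index_enum_uniq // -bigE; congr (E _ x).
  by apply/seteqP; split => t [i _ Ci]; exists i => //=; rewrite mem_index_enum.
elim: s => [|i s IHs] /=; first by rewrite !big_nil (pvm_set0 pvmE).
move=> /andP[ins us]; rewrite !big_cons pvmU // ?IHs // -bigE.
apply/seteqP; split => t // [Ci [j /= js Cj]].
have ij : i = j by apply: tC => //; exists t.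
by move: ins; rewrite ij js.
Qed.

Lemma pvm_orthogonal B C (x y : H) (a b : F) : borel_in B -> borel_in C ->
  B `&` C = set0 -> rip (a *: E B x) (b *: E C y) = 0.
Proof.
move=> bB bC BC; rewrite -!linearZ /= pvm_sym // pvmI // BC.
by rewrite (pvm_set0 pvmE) rip0r.
Qed.

Section Step.
Context (I : finType) (C : I -> set R) (c : I -> F) (x : H).
Hypotheses (bC : forall i, borel_in (C i)) (tC : trivIset setT C).

Lemma pvm_pythagoras :
  rnorm (\sum_i c i *: E (C i) x) ^+ 2 = \sum_i rnorm (c i) ^+ 2 * rnorm (E (C i) x) ^+ 2.
Proof.
rewrite rnorm_sqr_sum => [|i j ij]; first by apply: eq_bigr => i _; rewrite rnormZ exprMn.
apply: pvm_orthogonal => //; apply/eqP/negPn/negP => /set0P CC.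
by move/negP: ij; apply; apply/eqP; exact: tC.
Qed.

Lemma pvm_bigcup_sqr :
  rnorm (E (\bigcup_i C i) x) ^+ 2 = \sum_i rnorm (E (C i) x) ^+ 2.
Proof.
rewrite pvm_bigcup // rnorm_sqr_sum // => i j ij.
have := @pvm_orthogonal (C i) (C j) x x 1 1 (bC i) (bC j); rewrite !scale1r; apply.
apply/eqP/negPn/negP => /set0P CC.
by move/negP: ij; apply; apply/eqP; exact: tC.
Qed.

(** The coefficients are constrained only on pieces that charge x. This lets E-null pieces, where a
    step value may be arbitrary, be ignored. *)
Lemma pvm_step_le (b : R) : 0 <= b ->
  (forall i, E (C i) x != 0 -> rnorm (c i) <= b) ->
  rnorm (\sum_i c i *: E (C i) x) <= b * rnorm x.
Proof.
move=> b0 cb; rewrite -ler_sqr ?nnegrE ?mulr_ge0 ?rnorm_ge0 // pvm_pythagoras exprMn.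
apply: (@le_trans _ _ (b ^+ 2 * rnorm (E (\bigcup_i C i) x) ^+ 2)); last first.
  rewrite ler_wpM2l ?sqr_ge0 // ler_sqr ?nnegrE ?rnorm_ge0 //.
  exact/pvm_rnorm_le/borel_in_bigcup.
rewrite pvm_bigcup_sqr mulr_sumr; apply: ler_sum => i _.
have [->|Cx] := eqVneq (E (C i) x) 0; first by rewrite rnorm0 expr0n !mulr0.
by rewrite ler_wpM2r ?sqr_ge0 // ler_sqr ?nnegrE ?rnorm_ge0 // cb.
Qed.

Lemma pvm_step_ge (b : R) : 0 <= b ->
  (forall i, E (C i) x != 0 -> b <= rnorm (c i)) ->
  b * rnorm (E (\bigcup_i C i) x) <= rnorm (\sum_i c i *: E (C i) x).
Proof.
move=> b0 cb; rewrite -ler_sqr ?nnegrE ?mulr_ge0 ?rnorm_ge0 // pvm_pythagoras exprMn.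
rewrite pvm_bigcup_sqr mulr_sumr; apply: ler_sum => i _.
have [->|Cx] := eqVneq (E (C i) x) 0; first by rewrite rnorm0 expr0n !mulr0.
by rewrite ler_wpM2r ?sqr_ge0 // ler_sqr ?nnegrE ?rnorm_ge0 // cb.
Qed.

End Step.

Hypothesis diagE : forall x, exists m : {measure set (measurableTypeR R) -> \bar R},
  is_diag_measure ip S E x m.

Lemma diag_measureE x (m : {measure set (measurableTypeR R) -> \bar R}) B :
  is_diag_measure ip S E x m -> measurable B ->
  m B = (rnorm (E (B `&` S) x) ^+ 2)%:E.
Proof.
by move=> mx mB; rewrite mx // pvm_rnorm_sqr //; apply: borel_inIl => //; exact: borel_inS.
Qed.

(** Sigma-additivity of E is given for disjoint sequences only; the scalar measure mu_(x,x), which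
    takes the value |E(B)x|^2 at B, makes arbitrary countable unions of null sets null. *)
Lemma pvm_bigcup_eq0 (B : (set R)^nat) x :
  (forall n, borel_in (B n)) -> (forall n, E (B n) x = 0) -> E (\bigcup_n B n) x = 0.
Proof.
move=> bB B0; have [m mx] := diagE x.
have mB : measurable (\bigcup_n B n) by apply: bigcup_measurable => n _; exact: (bB n).1.
have : m (\bigcup_n B n) = 0%E.
  apply/negligibleP => //; apply: negligible_bigcup => n.
  apply/negligibleP; first exact: (bB n).1.
  apply: etrans (diag_measureE mx (bB n).1) _.
  by rewrite (setIidl (bB n).2) B0 rnorm0 expr0n.
rewrite (diag_measureE mx) // setIidl; last by move=> t [n _]; exact: (bB n).2.
by move=> -[] /eqP; rewrite sqrf_eq0 => /eqP /rnorm0_eq0.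
Qed.

(** Continuity from above of the finite measure mu_(x,x), read through mu_(x,x)(B) = |E(B)x|^2. *)
Lemma pvm_cvg0 (B : (set R)^nat) x (e : R) :
  (forall n, borel_in (B n)) -> (forall n m, (n <= m)%N -> B m `<=` B n) ->
  \bigcap_n B n = set0 -> 0 < e -> \forall n \near \oo, rnorm (E (B n) x) < e.
Proof.
move=> bB Bdec B0 e0; have [m mx] := diagE x.
have mE n : m (B n) = (rnorm (E (B n) x) ^+ 2)%:E.
  by rewrite (diag_measureE mx (bB n).1) (setIidl (bB n).2).
have := @nonincreasing_cvg_mu _ _ _ m B; rewrite B0 measure0 => cvgB.
have {}cvgB : m \o B @ \oo --> 0%E.
  apply: cvgB => [|n||n p np]; [by rewrite mE ltry | exact: (bB n).1 | exact: measurable0 |].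
  by apply/subsetPset; exact: Bdec.
have /cvgrPdist_lt : (fun n => rnorm (E (B n) x) ^+ 2) @ \oo --> (0 : R).
  have /fine_cvgP[_ h] := cvgB.
  by rewrite (_ : (fun n => _) = fine \o (m \o B)) //; apply/funext => n; rewrite /= mE.
move=> /(_ (e ^+ 2) (exprn_gt0 2 e0)); apply: filterS => n.
rewrite sub0r normrN ger0_norm ?sqr_ge0 // => h.
by rewrite -(@ltr_pXn2r _ 2) ?nnegrE ?rnorm_ge0 ?ltW.
Qed.

Definition truncation (n : nat) : set R := S `&` `[- n%:R, n%:R].

Lemma borel_in_truncation n : borel_in (truncation n).
Proof. by apply: borel_inI; [exact: borel_inS | exact: measurable_itv]. Qed.

Lemma truncationS n m : (n <= m)%N -> truncation n `<=` truncation m.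
Proof.
move=> nm t [St] /=; rewrite !in_itv /= => /andP[nt tn]; split => //=.
have : n%:R <= m%:R :> R by rewrite ler_nat.
by rewrite in_itv /=; lra.
Qed.

Lemma pvm_truncation_cvg x : E (truncation n) x @[n --> \oo] --> x.
Proof.
apply/cvg_rnormP => e e0.
have bT n : borel_in (S `\` truncation n).
  by apply: borel_inD; [exact: borel_inS | exact: (borel_in_truncation n).1].
have := @pvm_cvg0 (fun n => S `\` truncation n) x e bT.
have dec n m : (n <= m)%N -> S `\` truncation m `<=` S `\` truncation n.
  by move=> nm; apply: setDS; exact: truncationS.
have cap0 : \bigcap_n (S `\` truncation n) = set0.
  apply/seteqP; split => // t St; have [St' _] := St 0%N I.
  have [_] := St (Num.bound t) I; apply; split => //=.
  have := archi_boundP (normr_ge0 t); rewrite /Num.bound normr_id in_itv /=.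
  by rewrite -ler_norml => /ltW.
move=> /(_ dec cap0 e0); apply: filterS => n.
by rewrite {3}(pvm_split x (borel_in_truncation n)) opprD addrA subrr sub0r rnormN.
Qed.

(** Punctured intervals of radius 1/(n+1) around a decrease to the empty set. The centre must be
    removed because {a} may carry mass. *)
Lemma pvm_punctured (a : R) x (e : R) : 0 < e ->
  exists2 r : R, 0 < r & rnorm (E (S `&` (`]a - r, a + r[%classic `\ a)) x) < e.
Proof.
move=> e0; pose B n := S `&` (`]a - n.+1%:R^-1, a + n.+1%:R^-1[%classic `\ a).
have bB n : borel_in (B n).
  by apply: borel_inI; [exact: borel_inS | apply: measurableD => //; exact: measurable_itv].
have dec n m : (n <= m)%N -> B m `<=` B n.
  move=> nm; apply: setIS; apply: setSD => t /=; rewrite !in_itv /=.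
  have : m.+1%:R^-1 <= n.+1%:R^-1 :> R by rewrite lef_pV2 ?posrE // ler_nat.
  by move: n.+1%:R^-1 m.+1%:R^-1 => b c; lra.
have cap0 : \bigcap_n B n = set0.
  apply/seteqP; split => // t Bt; have [St [_ /= ta]] := Bt 0%N I.
  have ta0 : 0 < `|t - a| by rewrite normr_gt0 subr_eq0; apply/eqP.
  have [n _ /(_ n (leqnn n)) /=] := near_infty_natSinv_lt (PosNum ta0).
  have [_ [/= + _]] := Bt n I; rewrite in_itv /= => /andP[h1 h2].
  move: h1 h2; move: n.+1%:R^-1 => b h1 h2; rewrite ltNge => /negP; apply.
  by rewrite ler_norml; lra.
have [n _ /(_ n (leqnn n)) h] := pvm_cvg0 x bB dec cap0 e0.
by exists n.+1%:R^-1; rewrite ?invr_gt0.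
Qed.

End ProjectionValuedMeasure.

(** * Integrals against a measure that is another one restricted to B *)

Section ConcentratedMeasure.
Context {R : realType}.
Local Notation mR := (measurableTypeR R).
Context (m m' : {measure set mR -> \bar R}) (S B : set mR).
Hypotheses (mS : measurable S) (mB : measurable B) (BS : B `<=` S).
Hypotheses (mm' : forall C : set mR, measurable C -> C `<=` B -> m' C = m C).
Hypothesis (m'0 : m' (S `\` B) = 0%E).

Lemma ge0_integral_concentrated (f : mR -> \bar R) :
  measurable_fun setT f -> (forall t, 0 <= f t)%E ->
  (\int[m']_(t in S) f t = \int[m]_(t in B) f t)%E.
Proof.
move=> mf f0; rewrite (@ge0_negligible_integral _ _ _ m' S (S `\` B)) //.
- by rewrite setDD setIidr //; exact: eq_measure_integral.
- exact: measurableD.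
- exact: measurable_funTS.
Qed.

Lemma integral_concentrated (f : mR -> R) :
  m'.-integrable S (EFin \o f) ->
  \int[m']_(t in S) f t = \int[m]_(t in B) f t.
Proof.
move=> intf; rewrite /Rintegral (@negligible_integral _ _ _ m' S (S `\` B)) //.
  by rewrite setDD setIidr //; congr fine; exact: eq_measure_integral.
exact: measurableD.
Qed.

End ConcentratedMeasure.

(** * The quadratic form of A on the ranges of spectral projections *)

Section SpectralMeasure.
Context {R : realType} {k : scalar_kind}.
Local Notation F := (scalar_field R k).
Context {H : completeNormedModType F} (ip : {dot H for scalar_conj R k}).
Hypothesis hilbertH : is_hilbert ip.
Local Notation rip := (rip ip).
Context (A : operator H) (saA : self_adjoint ip A).
Context (E : set R -> {linear H -> H}) (EA : spectral_measure_of ip A E).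
Local Notation S := (rspectrum A).
Local Notation borel_in := (borel_in S).
Local Notation mR := (measurableTypeR R).
Let pvmE := EA.1.

Lemma measurable_rspectrum : measurable S.
Proof. by apply: closed_measurable; exact: (rspectrum_closed hilbertH saA). Qed.
Let mS := measurable_rspectrum.

Lemma spectral_diag x : exists m : {measure set mR -> \bar R}, is_diag_measure ip S E x m.
Proof. by have [m []] := EA.2 x; exists m. Qed.

Lemma measurable_sqr : measurable_fun setT (fun t : mR => (t ^+ 2)%:E).
Proof. by apply/measurable_EFinP; exact: measurable_funX. Qed.

Lemma diag_rspectrum_integrable x (m : {measure set mR -> \bar R}) :
  is_diag_measure ip S E x m -> (\int[m]_(t in S) (t ^+ 2)%:E < +oo)%E ->
  m.-integrable S (EFin \o id).
Proof.
move=> mx fin; apply/integrableP; split.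
  by apply/measurable_EFinP; exact: measurable_id.
(* As m is finite, |t| <= 1 + t^2 reduces integrability of t to the finite second moment. *)
apply: (@le_lt_trans _ _ (\int[m]_(t in S) (cst 1%:E t + (t ^+ 2)%:E))%E).
  apply: ge0_le_integral => //.
  - by apply: measurableT_comp => //; apply/measurable_EFinP; exact: measurable_id.
  - by apply: emeasurable_funD => //; apply: measurable_funTS; exact: measurable_sqr.
  - move=> t _ /=; rewrite -EFinD lee_fin.
    by have := sqr_ge0 (`|t| - 1); rewrite -[t ^+ 2]real_normK ?num_real //; nra.
rewrite ge0_integralD //.
- rewrite integral_cst // (diag_measureE hilbertH mS pvmE mx) //.
  by rewrite mul1e lte_add_pinfty // ltry.
- by move=> t _; rewrite lee_fin sqr_ge0.
- by apply: measurable_funTS; exact: measurable_sqr.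
Qed.

(** The measure of E(B)x is that of x restricted to B, because E(C)E(B) = E(C) for C inside B and
    E(C)E(B) = 0 for C disjoint from B. *)
Lemma diag_measure_concentrated B x (m m' : {measure set mR -> \bar R}) :
  borel_in B -> is_diag_measure ip S E x m -> is_diag_measure ip S E (E B x) m' ->
  (forall C : set mR, measurable C -> C `<=` B -> m' C = m C) /\ m' (S `\` B) = 0%E.
Proof.
move=> bB mx mx'; have bS := borel_inS mS; split=> [C mC CB|].
  rewrite (diag_measureE hilbertH mS pvmE mx) // (diag_measureE hilbertH mS pvmE mx') //.
  have CS : C `<=` S := subset_trans CB bB.2.
  by rewrite (setIidl CS) (pvm_subl pvmE).
have mSB : measurable (S `\` B) by apply: measurableD => //; exact: bB.1.
rewrite (diag_measureE hilbertH mS pvmE mx') // (setIidl (@subDsetl _ _ _)).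
by rewrite (pvmI pvmE) // setDKI (pvm_set0 pvmE) rnorm0 expr0n.
Qed.

Lemma pvm_dom B x : borel_in B -> dom A x -> dom A (E B x).
Proof.
move=> bB dx; have [m [mx domx _]] := EA.2 x; have [m' [mx' domx' _]] := EA.2 (E B x).
have [mm' m'0] := diag_measure_concentrated bB mx mx'.
apply/domx'; rewrite (ge0_integral_concentrated mS bB.1 bB.2 mm' m'0); last 2 first.
- exact: measurable_sqr.
- by move=> t; rewrite lee_fin sqr_ge0.
apply: le_lt_trans (domx.1 dx); apply: ge0_subset_integral => //.
- exact: bB.1.
- by apply: measurable_funTS; exact: measurable_sqr.
- by move=> t _; rewrite lee_fin sqr_ge0.
- exact: bB.2.
Qed.

Lemma pvm_bounded_dom B x (M : R) :
  borel_in B -> (forall t, B t -> `|t| <= M) -> dom A (E B x).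
Proof.
move=> bB BM; have [m [mx _ _]] := EA.2 x; have [m' [mx' domx' _]] := EA.2 (E B x).
have [mm' m'0] := diag_measure_concentrated bB mx mx'.
apply/domx'; rewrite (ge0_integral_concentrated mS bB.1 bB.2 mm' m'0); last 2 first.
- exact: measurable_sqr.
- by move=> t; rewrite lee_fin sqr_ge0.
apply: (@le_lt_trans _ _ (\int[m]_(t in B) cst (M ^+ 2)%:E t)%E).
  apply: ge0_le_integral => //.
  - exact: bB.1.
  - by move=> t _; rewrite lee_fin sqr_ge0.
  - by apply: measurable_funTS; exact: measurable_sqr.
  - move=> t /BM tM; rewrite lee_fin -[t ^+ 2]real_normK ?num_real //.
    by rewrite ler_sqr ?nnegrE // (le_trans _ tM).
rewrite integral_cst ?(diag_measureE hilbertH mS pvmE mx) ?ltry //; exact: bB.1.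
Qed.

Lemma quadratic_form_integral B x (m : {measure set mR -> \bar R}) :
  is_diag_measure ip S E x m -> borel_in B -> dom A x ->
  m.-integrable S (EFin \o id) /\ rip (A (E B x)) (E B x) = \int[m]_(t in B) t.
Proof.
move=> mx bB dx; have [m' [mx' domx' Ax']] := EA.2 (E B x).
have [mm' m'0] := diag_measure_concentrated bB mx mx'.
have dBx := pvm_dom bB dx; split.
  (* The measure m0 that comes with the domain criterion need not be the given m, but both agree on
     Borel sets. *)
  have [m0 [mx0 domx0 _]] := EA.2 x; apply: (diag_rspectrum_integrable mx).
  rewrite (@eq_measure_integral _ mR _ S m0); first exact: domx0.1.
  by move=> C mC _; rewrite mx // mx0.
rewrite /rip Ax' // of_realK (integral_concentrated mS bB.1 bB.2 mm' m'0) //.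
by apply: (diag_rspectrum_integrable mx'); exact: domx'.1.
Qed.

(** This stands in for commutation of A with E(B). Additivity of the integral over B and its
    complement removes the two cross terms from <Ax,x>; by symmetry of A they are equal, so each
    vanishes. *)
Lemma quadratic_form_split B x : borel_in B -> dom A x ->
  rip (A x) (E B x) = rip (A (E B x)) (E B x).
Proof.
move=> bB dx; have bS := borel_inS mS.
have bB' : borel_in (S `\` B) by apply: borel_inD => //; exact: bB.1.
have dBx := pvm_dom bB dx; have dBx' := pvm_dom bB' dx.
have [m mx] := spectral_diag x.
have [_ qB] := quadratic_form_integral mx bB dx.
have [_ qB'] := quadratic_form_integral mx bB' dx.
have [intm qS] := quadratic_form_integral mx bS dx.
have : rip (A x) x = rip (A (E B x)) (E B x) + rip (A (E (S `\` B) x)) (E (S `\` B) x).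
  have UE : B `|` (S `\` B) = S by rewrite setDUK //; exact: bB.2.
  rewrite -{1 2}(pvm_total pvmE x) qS qB qB' -[in LHS]UE.
  apply: Rintegral_setU; [exact: bB.1 | exact: bB'.1 | by rewrite UE |].
  by apply/disj_setPS => t [? []].
have Ax : A x = A (E B x) + A (E (S `\` B) x) by rewrite -op_add // -(pvm_split mS pvmE).
have h z : rip z x = rip z (E B x) + rip z (E (S `\` B) x).
  by rewrite -ripDr -(pvm_split mS pvmE).
have := self_adjoint_rip saA dBx dBx'; rewrite Ax !ripDl !h.
by move=> h1 h2; lra.
Qed.

Lemma quadratic_form_ge B x (c : R) : borel_in B -> dom A x -> E B x = x ->
  (forall t, B t -> c <= t) -> c * rnorm x ^+ 2 <= rip (A x) x.
Proof.
move=> bB dx Bx cB; have bS := borel_inS mS; have [m mx] := spectral_diag x.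
have [intm] := quadratic_form_integral mx bB dx; rewrite Bx => ->.
have intB : m.-integrable B (EFin \o id).
  by apply: (@integrableS _ mR _ m S B) => //; [exact: bB.1 | exact: bB.2].
have mBE : m B = (rnorm x ^+ 2)%:E.
  by rewrite (diag_measureE hilbertH mS pvmE mx bB.1) (setIidl bB.2) Bx.
rewrite -[rnorm x ^+ 2]/(fine (rnorm x ^+ 2)%:E) -mBE -Rintegral_cst; last exact: bB.1.
apply: le_Rintegral => //; first exact: bB.1.
apply/integrableP; split; first exact: measurable_cst.
by rewrite integral_cst ?mBE ?ltry //; exact: bB.1.
Qed.

Lemma quadratic_form_le B x (c : R) : borel_in B -> dom A x -> E B x = x ->
  (forall t, B t -> t <= c) -> rip (A x) x <= c * rnorm x ^+ 2.
Proof.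
move=> bB dx Bx cB; have bS := borel_inS mS; have [m mx] := spectral_diag x.
have [intm] := quadratic_form_integral mx bB dx; rewrite Bx => ->.
have intB : m.-integrable B (EFin \o id).
  by apply: (@integrableS _ mR _ m S B) => //; [exact: bB.1 | exact: bB.2].
have mBE : m B = (rnorm x ^+ 2)%:E.
  by rewrite (diag_measureE hilbertH mS pvmE mx bB.1) (setIidl bB.2) Bx.
rewrite -[rnorm x ^+ 2]/(fine (rnorm x ^+ 2)%:E) -mBE -Rintegral_cst; last exact: bB.1.
apply: le_Rintegral => //; first exact: bB.1.
apply/integrableP; split; first exact: measurable_cst.
by rewrite integral_cst ?mBE ?ltry //; exact: bB.1.
Qed.

End SpectralMeasure.

(** * The support of E is the spectrum, and its atoms are the eigenvalues *)

Section Support.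
Context {R : realType} {k : scalar_kind}.
Local Notation F := (scalar_field R k).
Local Notation "a %:F" := (of_real k a).
Context {H : completeNormedModType F} (ip : {dot H for scalar_conj R k}).
Hypothesis hilbertH : is_hilbert ip.
Local Notation rip := (rip ip).
Context (A : operator H) (saA : self_adjoint ip A).
Context (E : set R -> {linear H -> H}) (EA : spectral_measure_of ip A E).
Local Notation S := (rspectrum A).
Local Notation borel_in := (borel_in S).
Let pvmE := EA.1.
Let mS : measurable S := measurable_rspectrum hilbertH saA.
Let bS : borel_in S := borel_inS mS.
Let diagE := spectral_diag EA.

Lemma borel_in_itv (i : interval R) : borel_in (S `&` [set` i]).
Proof. by apply: borel_inI => //; exact: measurable_itv. Qed.

Lemma borel_in1 (c : R) : S c -> borel_in [set c].
Proof. by move=> Sc; split; [exact: measurable_set1 | move=> t ->]. Qed.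

(** If E vanished on the window, every x would split into parts living left and right of it, where A
    - c is at most -r and at least r; then A - c is bounded below by r and c is a resolvent
    point. *)
Lemma rspectrum_support (c r : R) : S c -> 0 < r ->
  exists x, x != 0 /\ E (S `&` `]c - r, c + r[%classic) x = x.
Proof.
move=> Sc r0; set B := S `&` _; have bB : borel_in B := borel_in_itv _.
apply: contrapT => noE; have E0 x : E B x = 0.
  apply: contrapT => /eqP Bx; apply: noE; exists (E B x); split => //.
  by rewrite (pvm_idem pvmE).
apply: Sc; apply: (self_adjoint_resolvent hilbertH saA r0) => x dx.
pose Bl := S `&` `]-oo, c - r]%classic; pose Br := S `&` `[c + r, +oo[%classic.
have bl : borel_in Bl := borel_in_itv _; have br : borel_in Br := borel_in_itv _.
have lr0 : Bl `&` Br = set0.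
  apply/seteqP; split => // t [[_ /=]] + [_ /=]; rewrite !in_itv /= => h1 /andP[h2 _].
  by lra.
have SB : S `\` B = Bl `|` Br.
  apply/seteqP; split => [t [St +]|t [] [St /=]]; rewrite ?in_itv /= ?andbT => h.
  - have [tl|tl] := leP t (c - r); first by left; split => //=; rewrite in_itv.
    have [tr|tr] := leP (c + r) t; first by right; split => //=; rewrite in_itv /= tr.
    by exfalso; apply: h; split => //=; rewrite in_itv /= tl.
  - by split=> // -[_ /=]; rewrite in_itv /= => /andP[]; lra.
  - by split=> // -[_ /=]; rewrite in_itv /= => /andP[]; lra.
have xE : x = E Bl x + E Br x.
  by rewrite {1}(pvm_split mS pvmE x bB) E0 add0r SB (pvmU pvmE).
have dl := pvm_dom hilbertH saA EA bl dx; have dr := pvm_dom hilbertH saA EA br dx.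
have ql := quadratic_form_le hilbertH saA EA bl dl (pvm_idem pvmE x bl) (c := c - r).
have qr := quadratic_form_ge hilbertH saA EA br dr (pvm_idem pvmE x br) (c := c + r).
have {}ql : rip (A x) (E Bl x) <= (c - r) * rnorm (E Bl x) ^+ 2.
  rewrite (quadratic_form_split hilbertH saA EA bl dx); apply: ql => t [_ /=].
  by rewrite in_itv.
have {}qr : (c + r) * rnorm (E Br x) ^+ 2 <= rip (A x) (E Br x).
  rewrite (quadratic_form_split hilbertH saA EA br dx); apply: qr => t [_ /=].
  by rewrite in_itv /= andbT.
have orth : rip (E Bl x) (E Br x) = 0.
  by have := pvm_orthogonal pvmE x x 1 1 bl br lr0; rewrite !scale1r.
have nx : rnorm x ^+ 2 = rnorm (E Bl x) ^+ 2 + rnorm (E Br x) ^+ 2.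
  by rewrite {1}xE (rnorm_sqrD hilbertH) orth mulr0 addr0.
have ny : rnorm (E Br x - E Bl x) = rnorm x.
  apply/eqP; rewrite -(@eqrXn2 _ 2) ?rnorm_ge0 // nx (rnorm_sqrD hilbertH) rnormN.
  by rewrite ripNr ripC orth oppr0 mulr0 addr0 addrC.
(* Flipping the sign of the left part makes both contributions positive, at least r|x|^2 in total,
   while the test vector keeps the norm of x. *)
have := rip_ler hilbertH (A x - c%:F *: x) (E Br x - E Bl x).
rewrite ny !ripE !(ripC ip x) -!(pvm_rnorm_sqr hilbertH pvmE) // => h.
have [->|x0] := eqVneq (rnorm x) 0; first by rewrite mulr0 rnorm_ge0.
have xp : 0 < rnorm x by rewrite lt_neqAle eq_sym x0 rnorm_ge0.
by rewrite -(ler_pM2r xp) -mulrA -expr2 nx; lra.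
Qed.

(** (A - c)x is tested against both parts of a vector z of the dense domain. On the range of E({c})
    the form of A is c|u|^2 and polarises; against the complementary part the cross term
    vanishes. *)
Lemma eigenvector_of_atom (c : R) x : S c -> E [set c] x = x ->
  dom A x /\ A x = c%:F *: x.
Proof.
move=> Sc cx; have bc := borel_in1 Sc.
have dx : dom A x.
  by rewrite -cx; apply: (pvm_bounded_dom hilbertH saA EA x bc (M := `|c|)) => t ->.
split=> //; apply/eqP; rewrite -subr_eq0; apply/eqP.
apply: (dense_rip_eq0 hilbertH saA.1) => z dz; rewrite ripC.
have quad u : dom A u -> E [set c] u = u -> rip (A u) u = c * rnorm u ^+ 2.
  move=> du cu; apply/le_anti; apply/andP; split.
    by apply: (quadratic_form_le hilbertH saA EA bc du cu) => t ->.
  by apply: (quadratic_form_ge hilbertH saA EA bc du cu) => t ->.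
have bc' : borel_in (S `\` [set c]) by apply: borel_inD => //; exact: bc.1.
have zE := pvm_split mS pvmE z bc.
set z1 := E [set c] z in zE; set z2 := E _ z in zE.
have cz1 : E [set c] z1 = z1 by rewrite /z1 (pvm_idem pvmE).
have cz2 : E [set c] z2 = 0.
  by rewrite /z2 (pvmI pvmE) // setDIK (pvm_set0 pvmE).
have d1 : dom A z1 := pvm_dom hilbertH saA EA bc dz.
have d2 : dom A z2 := pvm_dom hilbertH saA EA bc' dz.
have h1 : rip (A x - c%:F *: x) z1 = 0.
  have := quad (x + z1) (dom_add dx d1).
  rewrite linearD cx cz1 op_add // (rnorm_sqrD hilbertH) => /(_ erefl).
  rewrite !ripE (quad x) // (quad z1) // (self_adjoint_rip saA d1 dx); lra.
have h2 : rip (A x - c%:F *: x) z2 = 0.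
  have xz : rip x z2 = 0 by rewrite -cx (pvm_sym pvmE) // cz2 rip0r.
  have := quadratic_form_split hilbertH saA EA bc (dom_add dx d2).
  rewrite linearD cx cz2 addr0 op_add // !ripE (self_adjoint_rip saA d2 dx).
  by rewrite xz; lra.
by rewrite zE ripDr h1 h2 addr0.
Qed.

(** On a set B that stays e away from c on one side, the form at E(B)x equals c|E(B)x|^2 and yet
    differs from it by at least e|E(B)x|^2, so E(B)x = 0. Countably many such sets exhaust the
    complement of c. *)
Lemma atom_of_eigenvalue (c : R) : rpoint_spectrum A c ->
  exists x, x != 0 /\ E [set c] x = x.
Proof.
move=> pc; have Sc := rpoint_spectrum_sub pc.
have [x [dx x0 Ax]] := pc; have bc := borel_in1 Sc.
have bc' : borel_in (S `\` [set c]) by apply: borel_inD => //; exact: bc.1.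
exists x; split => //; rewrite [RHS](pvm_split mS pvmE x bc) -[LHS]addr0; congr (_ + _).
have piece B (e : R) : borel_in B -> 0 < e ->
    (forall t, B t -> c + e <= t) \/ (forall t, B t -> t <= c - e) -> E B x = 0.
  move=> bB e0 Be; apply: rnorm0_eq0; apply/eqP; rewrite -sqrf_eq0; apply/eqP/le_anti.
  rewrite sqr_ge0 andbT; have dB := pvm_dom hilbertH saA EA bB dx.
  have := quadratic_form_split hilbertH saA EA bB dx.
  rewrite Ax ripZl (ripC ip x) -(pvm_rnorm_sqr hilbertH pvmE) // => q.
  case: Be => Be.
    have := quadratic_form_ge hilbertH saA EA bB dB (pvm_idem pvmE x bB) Be.
    by rewrite -q => h; rewrite -(ler_pM2l e0); lra.
  have := quadratic_form_le hilbertH saA EA bB dB (pvm_idem pvmE x bB) Be.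
  by rewrite -q => h; rewrite -(ler_pM2l e0); lra.
pose Br n := S `&` `[c + n.+1%:R^-1, +oo[%classic.
pose Bl n := S `&` `]-oo, c - n.+1%:R^-1]%classic.
have n0 n : 0 < n.+1%:R^-1 :> R by rewrite invr_gt0.
have br0 : E (\bigcup_n Br n) x = 0.
  apply: (pvm_bigcup_eq0 hilbertH mS pvmE diagE) => n; first exact: borel_in_itv.
  apply: (piece _ n.+1%:R^-1) => //; first exact: borel_in_itv.
  by left => t [_ /=]; rewrite in_itv /= andbT.
have bl0 : E (\bigcup_n Bl n) x = 0.
  apply: (pvm_bigcup_eq0 hilbertH mS pvmE diagE) => n; first exact: borel_in_itv.
  apply: (piece _ n.+1%:R^-1) => //; first exact: borel_in_itv.
  by right => t [_ /=]; rewrite in_itv.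
have bU (B : (set R)^nat) : (forall n, borel_in (B n)) -> borel_in (\bigcup_n B n).
  move=> bB; split; first by apply: bigcup_measurable => n _; exact: (bB n).1.
  by move=> t [n _]; exact: (bB n).2.
have bbl : borel_in (\bigcup_n Bl n) by apply: bU => n; exact: borel_in_itv.
have bbr : borel_in (\bigcup_n Br n) by apply: bU => n; exact: borel_in_itv.
have sub : S `\` [set c] `<=` (\bigcup_n Bl n) `|` (\bigcup_n Br n).
  move=> t [St /= /eqP tc]; have tc0 : 0 < `|t - c| by rewrite normr_gt0 subr_eq0.
  have [n _ /(_ n (leqnn n)) /=] := near_infty_natSinv_lt (PosNum tc0).
  move: tc; rewrite neq_lt => /orP[tc|tc] h; [left|right]; exists n => //; split => //=.
    by move: h; rewrite in_itv /= ltr0_norm ?subr_lt0 //; move: n.+1%:R^-1 => b; lra.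
  by move: h; rewrite in_itv /= gtr0_norm ?subr_gt0 // andbT; move: n.+1%:R^-1 => b; lra.
apply/esym/(pvm_sub_eq0 pvmE bc' _ sub); first exact: borel_inU.
rewrite (pvmU pvmE) // ?bl0 ?br0 ?addr0 //; apply/seteqP; split => // t.
move=> [[n _ [_ /= +]] [m _ [_ /= +]]]; rewrite !in_itv /= andbT.
by have := n0 n; have := n0 m; move: n.+1%:R^-1 m.+1%:R^-1 => a b; lra.
Qed.

Lemma bounded_rspectrum : bounded_operator A ->
  exists n : nat, S `<=` `[- n%:R, n%:R]%classic.
Proof.
move=> [domT [M0 Mb]].
have [M Mle] : exists M : R, forall x, rnorm (A x) <= M * rnorm x.
  exists (rnorm M0) => x; rewrite -(@of_real_le _ k) of_realM !rnormE.
  have Mx := Mb x; have := ger0_norm (le_trans (normr_ge0 _) Mx).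
  by rewrite normrM normr_id => ->.
have key c : S c -> `|c| <= M.
  (* With r half the excess of |c| over M, a vector in the window of radius r around c satisfies
     |<Ax,x>| >= (M + r)|x|^2, against the bound M. *)
  move=> Sc; rewrite leNgt; apply/negP => cM; pose r := (`|c| - M) / 2.
  have r0 : 0 < r by rewrite divr_gt0 // subr_gt0.
  have [x [x0 cx]] := rspectrum_support Sc r0.
  have dx : dom A x by rewrite domT.
  have xp : 0 < rnorm x ^+ 2.
    by rewrite exprn_gt0 // lt_neqAle rnorm_ge0 andbT eq_sym; apply: contra_neq x0 => /rnorm0_eq0.
  have := le_trans (rip_le hilbertH (A x) x) (ler_wpM2r (rnorm_ge0 x) (Mle x)).
  rewrite -mulrA -expr2 ler_norml => /andP[q1 q2].
  have [c0|c0] := leP 0 c.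
    have := quadratic_form_ge hilbertH saA EA (borel_in_itv _) dx cx (c := c - r).
    case/(_ _)/Wrap => [t [_ /=]|h]; first by rewrite in_itv /= => /andP[/ltW].
    have rE : c - r - M = r by rewrite /r ger0_norm //; lra.
    have : (c - r - M) * rnorm x ^+ 2 <= 0 by lra.
    rewrite rE.
    by rewrite leNgt mulr_gt0.
  have := quadratic_form_le hilbertH saA EA (borel_in_itv _) dx cx (c := c + r).
  case/(_ _)/Wrap => [t [_ /=]|h]; first by rewrite in_itv /= => /andP[_ /ltW].
  have rE : - c - r - M = r by rewrite /r ltr0_norm //; lra.
  have : (- c - r - M) * rnorm x ^+ 2 <= 0 by lra.
  rewrite rE.
  by rewrite leNgt mulr_gt0.
exists (Num.bound M) => c Sc /=; rewrite in_itv /= -ler_norml.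
apply: le_trans (key _ Sc) _; apply: le_trans (ler_norm M) _.
have := archi_boundP (normr_ge0 M); rewrite /Num.bound normr_id => /ltW; exact.
Qed.

End Support.

(** * Cousin's lemma: fine tagged partitions exist *)

Section Cousin.
Context {R : realType}.
Implicit Types (K : set R) (gamma : R -> R).

(** A fine partition built up to b, excluded. Half-open pieces allow the next cell to start at b
    without overlap. *)
Definition fine_chain K gamma (a b : R) := exists (p : seq R) (n : nat)
    (t : 'I_n -> R) (C : 'I_n -> set R),
  [/\ (0 < size p)%N, sorted <%R p, head 0 p = a & last 0 p = b] /\
  [/\ forall j, cell K p (C j), \bigcup_j C j = K `&` `]-oo, b[%classic,
      trivIset setT C, forall j, C j (t j) & gauge_fine gamma t C].

Lemma cell_rcons K (p : seq R) c C : cell K p C -> cell K (rcons p c) C.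
Proof.
move=> [i [b1 [b2 [ip ->]]]]; exists i, b1, b2; rewrite size_rcons; split; first exact: ltnW.
by rewrite !nth_rcons ip (ltnW ip).
Qed.

Lemma cell_last K (p : seq R) b : (0 < size p)%N ->
  cell K (rcons p b) (K `&` `[last 0 p, b[%classic).
Proof.
move=> p0; exists (size p).-1, true, true; rewrite size_rcons (prednK p0) ltnSn; split=> //.
by rewrite !nth_rcons ltnn eqxx prednK // leqnn nth_last.
Qed.

(** Where [b,c) misses K only the division grows and no cell is added, since an empty cell could not
    hold its tag. *)
Lemma fine_chain_ext K gamma (a b c : R) : fine_chain K gamma a b -> b < c ->
  K `&` `[b, c[%classic = set0 \/
  (exists s, [/\ K s, b <= s < c &
     K `&` `[b, c[%classic `<=` [set u | s - gamma s < u < s + gamma s]]) ->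
  fine_chain K gamma a c.
Proof.
move=> [p [n [t [C [[p0 ps pa pb] [pC UC tC Ct fineC]]]]]] bc ext.
have p' : [/\ (0 < size (rcons p c))%N, sorted <%R (rcons p c), head 0 (rcons p c) = a &
    last 0 (rcons p c) = c].
  rewrite size_rcons last_rcons; split=> //.
    by case: p p0 ps pb {pC pa} => //= x p _ xp xpb; rewrite rcons_path xp xpb.
  by case: p p0 pa {ps pC pb}.
have Usplit : K `&` `]-oo, c[%classic = (K `&` `]-oo, b[%classic) `|` (K `&` `[b, c[%classic).
  rewrite -setIUr; congr (_ `&` _); apply/seteqP; split => u /=; rewrite !in_itv /=.
    by have [ub|ub] := ltP u b => uc; [left | right].
  by case=> [ub|/andP[]//]; exact: lt_trans bc.
case: ext => [K0|[s [Ks bsc sfine]]].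
  exists (rcons p c), n, t, C; split=> //; split=> // [j|]; first exact: cell_rcons.
  by rewrite Usplit K0 setU0.
pose t' (j : 'I_n.+1) := if unlift ord_max j is Some i then t i else s.
pose C' (j : 'I_n.+1) := if unlift ord_max j is Some i then C i else K `&` `[b, c[%classic.
have CK j : C j `<=` K `&` `]-oo, b[%classic by rewrite -UC => u Cu; exists j.
have disj j : C j `&` (K `&` `[b, c[%classic) = set0.
  apply/seteqP; split=> // u [/CK[_ /=] + [_ /=]]; rewrite !in_itv /= => ub /andP[bu _].
  by move: (lt_le_trans ub bu); rewrite ltxx.
exists (rcons p c), n.+1, t', C'; split=> //; split.
- move=> j; rewrite /C'; case: (unliftP ord_max j) => [i _|_]; first exact: cell_rcons.
  by rewrite -pb; exact: cell_last.
- rewrite Usplit -UC; apply/seteqP; split => [u [j _]|u [[j _ Cj]|Ku]].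
  + by rewrite /C'; case: (unliftP ord_max j) => [i _ Ci|_ Ku]; [left; exists i | right].
  + by exists (lift ord_max j) => //; rewrite /C' liftK.
  + by exists ord_max => //; rewrite /C' unlift_none.
- move=> i j _ _; rewrite /C'; case: (unliftP ord_max i) => [i' ->|->];
    case: (unliftP ord_max j) => [j' ->|->] //.
  + by move/(tC i' j' I I) => ->.
  + by rewrite disj => -[].
  + by rewrite setIC disj => -[].
- by move=> j; rewrite /C' /t'; case: (unliftP ord_max j) => [i _|_] //; split.
- by move=> j; rewrite /C' /t'; case: (unliftP ord_max j) => [i _|_].
Qed.

Lemma cousin K gamma (M : R) : closed K -> (forall t, K t -> - M <= t <= M) ->
  gauge K gamma -> exists n (t : 'I_n -> R) (C : 'I_n -> set R),
  tagged_partition K t C /\ gauge_fine gamma t C.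
Proof.
move=> Kc KM Kg; pose a := - M - 1; pose X := [set b | fine_chain K gamma a b].
(* The strict inequality M < c, like the start at -M - 1, puts K strictly between the end points of
   the division. *)
suff [c [Mc [p [n [t [C [[p0 ps pa pb] [pC UC tC Ct fineC]]]]]]]] : exists c, M < c /\ X c.
  exists n, t, C; split => //; split => //.
  - exists p => //; split=> // u /KM/andP[Mu uM]; rewrite pa pb /a (le_lt_trans uM) // andbT.
    by lra.
  - rewrite UC; apply/setIidl => u /KM/andP[_ uM] /=.
    by rewrite in_itv /=; exact: le_lt_trans Mc.
  - by move=> j i; split=> [Cij|->//]; apply: tC => //; exists (t j); split.
apply: contrapT => noc.
have XM b : X b -> b <= M by move=> Xb; rewrite leNgt; apply/negP => Mb; apply: noc; exists b.
have Xa : X a.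
  exists [:: a], 0%N, (fun=> 0), (fun=> set0); split=> //.
  split; [by case| |by case|by case|by case].
  rewrite bigcup0 //; apply/esym/seteqP; split => // u [/KM/andP[Mu _] /=].
  by rewrite in_itv /= /a; lra.
have supX : has_sup X by split; [exists a | exists M => b; exact: XM].
(* One step can cross [sup X]: if it lies in K it serves as the tag of a fine cell, otherwise
   closedness of K leaves a neighbourhood free of K. Crossing it contradicts the supremum. *)
have [e e0 ext] : exists2 e : R, 0 < e & forall b c, sup X - e < b -> b <= sup X ->
    sup X < c -> c < sup X + e ->
    K `&` `[b, c[%classic = set0 \/
    (exists s, [/\ K s, b <= s < c &
     K `&` `[b, c[%classic `<=` [set u | s - gamma s < u < s + gamma s]]).
  have [Ks|nKs] := pselect (K (sup X)).
    exists (gamma (sup X)); first exact: Kg.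
    move=> b c h1 h2 h3 h4; right; exists (sup X); split => //; first by rewrite h2.
    by move=> u [_ /=]; rewrite in_itv /= => /andP[bu uc]; lra.
  have : open (~` K) by exact: closed_openC.
  rewrite openE => /(_ _ nKs) /nbhs_ballP[e /= e0 eK]; exists e => // b c h1 h2 h3 h4; left.
  apply/seteqP; split => // u [Ku /=]; rewrite in_itv /= => /andP[bu uc].
  apply: eK Ku; rewrite -ball_normE /= ltr_norml; lra.
have [b Xb eb] := sup_adherent e0 supX.
have /ext := eb => /(_ (sup X + e / 2)) ext'.
have Xb' : X (sup X + e / 2).
  apply: (fine_chain_ext Xb).
    by have := sup_ubound supX.2 Xb; lra.
  by apply: ext'; [exact: (sup_ubound supX.2) | lra | lra].
by have := sup_ubound supX.2 Xb'; lra.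
Qed.

End Cousin.

(** * The vector-valued HK integral and its relation to the scalar one *)

Section VectorIntegral.
Context {R : realType} {k : scalar_kind}.
Local Notation F := (scalar_field R k).
Local Notation "a %:F" := (of_real k a).
Context {H : completeNormedModType F} (ip : {dot H for scalar_conj R k}).
Hypothesis hilbertH : is_hilbert ip.
Context (S : set R) (closedS : closed S) (E : set R -> {linear H -> H}).
Hypothesis pvmE : projection_valued_measure ip S E.
Hypothesis diagE : forall x, exists m : {measure set (measurableTypeR R) -> \bar R},
  is_diag_measure ip S E x m.
Local Notation borel_in := (borel_in S).
Local Notation T := (truncation S).
Let mS : measurable S := closed_measurable closedS.
Let bT n : borel_in (T n) := borel_in_truncation mS n.

(* The HK integral of f with respect to the vector measure B |-> E B x. *)
Definition vector_integral (K : set R) (x : H) (f : R -> F) (v : H) : Prop :=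
  forall e : R, 0 < e -> exists2 gamma, gauge K gamma &
    forall (n : nat) (t : 'I_n -> R) (C : 'I_n -> set R),
      tagged_partition K t C -> gauge_fine gamma t C ->
      rnorm (\sum_(j < n) f (t j) *: E (C j) x - v) < e.

Lemma gauge_min (K : set R) (g1 g2 : R -> R) : gauge K g1 -> gauge K g2 -> gauge K (g1 \min g2).
Proof. by move=> h1 h2 t Kt /=; rewrite lt_min h1 // h2. Qed.

Lemma gauge_fine_min (g1 g2 : R -> R) n (t : 'I_n -> R) C :
  gauge_fine (g1 \min g2) t C -> gauge_fine g1 t C /\ gauge_fine g2 t C.
Proof.
have m1 s : (g1 \min g2) s <= g1 s by rewrite /= ge_min lexx.
have m2 s : (g1 \min g2) s <= g2 s by rewrite /= ge_min lexx orbT.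
move=> h; split => j u /h /andP[]; have := m1 (t j); have := m2 (t j).
  by move: ((g1 \min g2) (t j)) => a h1 h2 h3 h4; apply/andP; lra.
by move: ((g1 \min g2) (t j)) => a h1 h2 h3 h4; apply/andP; lra.
Qed.

Lemma truncation_cousin n gamma : gauge (T n) gamma ->
  exists m (t : 'I_m -> R) (C : 'I_m -> set R),
  tagged_partition (T n) t C /\ gauge_fine gamma t C.
Proof.
apply: (@cousin _ _ _ n%:R); first by apply: closedI => //; exact: itv_closed.
by move=> t [_ /=]; rewrite in_itv.
Qed.

Section TaggedPartition.
Context (K : set R) (n : nat) (t : 'I_n -> R) (C : 'I_n -> set R).
Hypotheses (bK : borel_in K) (tpC : tagged_partition K t C).

Lemma tagged_partition_sub j : C j `<=` K.
Proof. by have [_ <- _ _] := tpC => u Cu; exists j. Qed.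

Lemma tagged_partition_borel j : borel_in (C j).
Proof.
have [[p _ /(_ j)[i [b1 [b2 [_ ->]]]]] _ _ _] := tpC.
by apply: borel_inI => //; exact: measurable_itv.
Qed.

Lemma tagged_partition_tag j : C j (t j).
Proof. by have [_ _ _ tagC] := tpC; apply/tagC. Qed.

Lemma tagged_partition_mem j : K (t j).
Proof. exact/tagged_partition_sub/tagged_partition_tag. Qed.

End TaggedPartition.

(** A partition fine for both gauges exists by Cousin's lemma; its Riemann sum is close to both
    candidates. *)
Lemma vector_integral_unique n x f v w :
  vector_integral (T n) x f v -> vector_integral (T n) x f w -> v = w.
Proof.
move=> hv hw; apply/eqP; rewrite -subr_eq0; apply/eqP/rnorm_le0/ler_addgt0Pr => e e0.
have e2 : 0 < e / 2 by rewrite divr_gt0.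
have [g1 g1g h1] := hv _ e2; have [g2 g2g h2] := hw _ e2.
have [m [t [C [tp /gauge_fine_min[f1 f2]]]]] := truncation_cousin (gauge_min g1g g2g).
have := h1 _ _ _ tp f1; have := h2 _ _ _ tp f2; set s := \sum_j _ => a b.
by have := rnorm_tri s v w; rewrite (rnormBC v s); lra.
Qed.

Lemma HK_integral_unique n (mu : set R -> F) f v w :
  HK_integral (T n) mu f v -> HK_integral (T n) mu f w -> v = w.
Proof.
move=> hv hw; apply/eqP; rewrite -subr_eq0; apply/eqP/rnorm_le0/ler_addgt0Pr => e e0.
have e2 : 0 < e / 2 by rewrite divr_gt0.
have [g1 g1g h1] := hv _ e2; have [g2 g2g h2] := hw _ e2.
have [m [t [C [tp /gauge_fine_min[f1 f2]]]]] := truncation_cousin (gauge_min g1g g2g).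
have := h1 _ _ _ tp f1; have := h2 _ _ _ tp f2; rewrite -!rnorm_lt; set s := \sum_j _ => a b.
by have := rnorm_tri s v w; rewrite (rnormBC v s); lra.
Qed.

Lemma vector_integral_ext K x f g v : (forall t, K t -> f t = g t) ->
  vector_integral K x f v -> vector_integral K x g v.
Proof.
move=> fg hf e e0; have [ga gga h] := hf e e0; exists ga => // n t C tp fine.
have := h _ _ _ tp fine; congr (rnorm (_ - _) < _); apply: eq_bigr => j _.
by rewrite fg //; exact: tagged_partition_mem tp j.
Qed.

(** Common source of linearity in the integrand and linearity in the vector, which differ only in
    the termwise identity. *)
Lemma vector_integral_comb K (a : F) x y z f g h v w :
  (forall B, borel_in B -> forall s, K s ->
     h s *: E B z = a *: (f s *: E B x) + g s *: E B y) ->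
  borel_in K ->
  vector_integral K x f v -> vector_integral K y g w -> vector_integral K z h (a *: v + w).
Proof.
move=> hfg bK hv hw e e0; have a1 : 0 < rnorm a + 1 by have := rnorm_ge0 a; lra.
have e2 : 0 < e / 2 by rewrite divr_gt0.
have [g1 g1g h1] := hv _ (divr_gt0 e2 a1); have [g2 g2g h2] := hw _ e2.
exists (g1 \min g2); first exact: gauge_min.
move=> n t C tp /gauge_fine_min[f1 f2].
have := h1 _ _ _ tp f1; have := h2 _ _ _ tp f2.
under [X in _ -> _ -> rnorm (X - _) < _]eq_bigr => j _.
  rewrite (hfg _ (tagged_partition_borel bK tp j)); last exact: tagged_partition_mem tp j.
  over.
rewrite big_split /= -scaler_sumr opprD addrACA -scalerBr => b2.
rewrite ltr_pdivlMr // => b1; apply: le_lt_trans (rnormD _ _) _; rewrite rnormZ.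
move: b1 b2; set u := \sum_(_ < n) _ - v; have := rnorm_ge0 u.
by move: (rnorm u) (rnorm a) (rnorm (_ - w)) => b c d; lra.
Qed.

Lemma vector_integral_linear K (a : F) x f g v w : borel_in K ->
  vector_integral K x f v -> vector_integral K x g w ->
  vector_integral K x (fun t => a * f t + g t) (a *: v + w).
Proof. by move=> bK; apply: vector_integral_comb => // B _ s _; rewrite scalerDl scalerA. Qed.

Lemma vector_integral_linearr K (a : F) x y f v w : borel_in K ->
  vector_integral K x f v -> vector_integral K y f w ->
  vector_integral K (a *: x + y) f (a *: v + w).
Proof.
move=> bK; apply: vector_integral_comb => // B _ s _.
by rewrite linearP scalerDr !scalerA mulrC.
Qed.

Lemma vector_integral0 K x : vector_integral K x (fun=> 0) 0.
Proof.
move=> e e0; exists (fun=> 1) => [t _|n t C _ _]; first exact: ltr01.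
by rewrite big1 ?subr0 ?rnorm0 // => j _; rewrite scale0r.
Qed.

Lemma vector_integral_sum K (I : finType) (c : I -> F) (f : I -> R -> F) (v : I -> H) x :
  borel_in K -> (forall i, vector_integral K x (f i) (v i)) ->
  vector_integral K x (fun t => \sum_i c i * f i t) (\sum_i c i *: v i).
Proof.
move=> bK hf; elim: (index_enum I) => [|i s IHs].
  rewrite big_nil; apply: vector_integral_ext (vector_integral0 K x) => t _.
  by rewrite big_nil.
rewrite big_cons; apply: vector_integral_ext (vector_integral_linear (c i) bK (hf i) IHs) => t _.
by rewrite big_cons.
Qed.

Lemma vector_integral_pvm K B x f v : borel_in K -> borel_in B ->
  vector_integral K x f v -> vector_integral K (E B x) f (E B v).
Proof.
move=> bK bB hf e e0; have [ga gga h] := hf e e0; exists ga => // n t C tp fine.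
apply: le_lt_trans (h _ _ _ tp fine).
rewrite (_ : \sum_j _ = E B (\sum_(j < n) f (t j) *: E (C j) x)); last first.
  rewrite linear_sum; apply: eq_bigr => j _; rewrite linearZ /= (pvmC pvmE) //.
  exact: tagged_partition_borel tp j.
by rewrite -linearB (pvm_rnorm_le hilbertH pvmE).
Qed.

Lemma vector_integral_le n x f v (c : R) : 0 <= c ->
  (forall t, T n t -> rnorm (f t) <= c) -> vector_integral (T n) x f v ->
  rnorm v <= c * rnorm x.
Proof.
move=> c0 fc hf; apply/ler_addgt0Pr => e e0; have [ga gga h] := hf e e0.
have [m [t [C [tp fine]]]] := truncation_cousin gga.
have := h _ _ _ tp fine; set s := \sum_j _ => sv.
have : rnorm s <= c * rnorm x.
  apply: (pvm_step_le hilbertH pvmE) => //.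
  - by move=> j; exact: tagged_partition_borel tp j.
  - by have [] := tp.
  - by move=> j _; apply: fc; exact: tagged_partition_mem tp j.
have := rnormD (v - s) s; rewrite subrK rnormBC; lra.
Qed.

Lemma vector_integral_sum_le n x f g v m (t : 'I_m -> R) C (e : R) :
  0 <= e -> (forall t, T n t -> rnorm (f t - g t) <= e) -> tagged_partition (T n) t C ->
  rnorm (\sum_j f (t j) *: E (C j) x - v) <=
  e * rnorm x + rnorm (\sum_j g (t j) *: E (C j) x - v).
Proof.
move=> e0 fg tp; set s := \sum_j f _ *: _; set s' := \sum_j g _ *: _.
apply: le_trans (rnorm_tri s' _ _) _; rewrite lerD2r /s /s' -sumrB.
under eq_bigr do rewrite -scalerBl.
apply: (pvm_step_le hilbertH pvmE) => //.
- by move=> j; exact: tagged_partition_borel tp j.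
- by have [] := tp.
- by move=> j _; apply: fg; exact: tagged_partition_mem tp j.
Qed.

(** Integrals of approximants within 1/(m+1) of f form a Cauchy sequence by the sup-norm bound; the
    gauge of one good approximant serves for f, with three errors of e/3. *)
Lemma vector_integral_uniform n x f :
  (forall e : R, 0 < e -> exists g v,
     (forall t, T n t -> rnorm (f t - g t) <= e) /\ vector_integral (T n) x g v) ->
  exists v, vector_integral (T n) x f v.
Proof.
move=> approx.
have n0 m : 0 < m.+1%:R^-1 :> R by rewrite invr_gt0.
have /choice[g /choice[v gv]] m := approx _ (n0 m).
have vv p q : rnorm (v p - v q) <= (p.+1%:R^-1 + q.+1%:R^-1) * rnorm x.
  have [fp hp] := gv p; have [fq hq] := gv q.
  have := vector_integral_linear (-1) (bT n) hq hp.
  rewrite scaleN1r addrC; apply: vector_integral_le; first by rewrite addr_ge0 // ltW.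
  move=> t Tt; rewrite mulN1r addrC; apply: le_trans (rnorm_tri (f t) _ _) _.
  by rewrite rnormBC lerD ?fp ?fq.
have x1 : 0 < rnorm x + 1 by have := rnorm_ge0 x; lra.
have [w vw] : exists w : H, v @ \oo --> w.
  apply: cauchy_rnorm_cvg => e e0.
  have e2 : 0 < e / 2 / (rnorm x + 1) by rewrite !divr_gt0.
  have := near_infty_natSinv_lt (PosNum e2); apply: filterS => p /= hp q pq.
  have qp : q.+1%:R^-1 <= p.+1%:R^-1 :> R by rewrite lef_pV2 ?posrE // ler_nat.
  apply: le_lt_trans (vv q p) _; move: hp; rewrite ltr_pdivlMr //.
  move: (n0 q) (n0 p) qp (rnorm_ge0 x).
  move: p.+1%:R^-1 q.+1%:R^-1 => a b; nra.
exists w => e e0; have e3 : 0 < e / 3 by rewrite divr_gt0.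
have e3x : 0 < e / 3 / (rnorm x + 1) by rewrite divr_gt0.
have := near_infty_natSinv_lt (PosNum e3x); have := (cvg_rnormP _ _).1 vw _ e3.
move=> /(filterI _) /[apply] -[p _ /(_ p (leqnn p)) [/= hp1 /= hp2]].
have [fp /(_ _ e3)[ga gga h]] := gv p; exists ga => // m t C tp fine.
have := h _ _ _ tp fine.
have := vector_integral_sum_le x w (ltW (n0 p)) fp tp.
have := rnorm_tri (v p) (\sum_j g p (t j) *: E (C j) x) w.
move: hp1 hp2; rewrite ltr_pdivlMr //; move: (n0 p) (rnorm_ge0 x).
move: p.+1%:R^-1 (rnorm x) (rnorm (v p - w)) => a b c.
move: (rnorm (_ - w)) (rnorm (_ - w)) (rnorm (_ - v p)) => d d' d''.
by rewrite mulrDr mulr1; lra.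
Qed.

Lemma vector_integral_HK K x y f v : borel_in K -> vector_integral K x f v ->
  HK_integral K (spectral_mu ip E x y) f (ip v y).
Proof.
move=> bK hf e e0; have y1 : 0 < rnorm y + 1 by have := rnorm_ge0 y; lra.
have [ga gga h] := hf _ (divr_gt0 e0 y1); exists ga => // n t C tp fine.
have := h _ _ _ tp fine; rewrite -rnorm_lt.
rewrite (_ : \sum_j _ - ip v y = ip (\sum_(j < n) f (t j) *: E (C j) x - v) y); last first.
  rewrite linearBl; congr (_ - _); rewrite linear_sumlz.
  by apply: eq_bigr => j _; rewrite linearZl_LR.
have := rnorm_ip hilbertH (\sum_(j < n) f (t j) *: E (C j) x - v) y.
rewrite ltr_pdivlMr //; have := rnorm_ge0 (\sum_(j < n) f (t j) *: E (C j) x - v).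
by have := rnorm_ge0 y; nra.
Qed.

(* Orthogonality turns the Riemann sum of |f|^2 against mu_(x, x) into the squared norm of the
   vector Riemann sum of f. *)
Lemma vector_integral_HK_sqr K x f v : borel_in K -> vector_integral K x f v ->
  HK_integral K (spectral_mu ip E x x) (fun t => `|f t| ^+ 2) ((rnorm v ^+ 2)%:F).
Proof.
move=> bK hf e e0; pose N := rnorm v.
have N1 : 0 < 2 * N + 1 by have := rnorm_ge0 v; rewrite -/N; lra.
(* The minimum with 1 gives |s| + N <= 2N + 1, so that ||s|^2 - N^2| <= |s - v| (|s| + N) < e. *)
have d0 : 0 < Num.min 1 (e / (2 * N + 1)) by rewrite lt_min ltr01 divr_gt0.
have [ga gga h] := hf _ d0; exists ga => // n t C tp fine.
have := h _ _ _ tp fine; set s := \sum_j _; rewrite lt_min ltr_pdivlMr // => /andP[h1 h2].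
rewrite (_ : \sum_(j < n) _ = (rnorm s ^+ 2)%:F); last first.
  rewrite /s (pvm_pythagoras hilbertH pvmE); last 2 first.
  - by move=> j; exact: tagged_partition_borel tp j.
  - by have [] := tp.
  rewrite (big_morph (of_real k) (@of_realD R k) (@of_real0 R k)); apply: eq_bigr => j _.
  rewrite of_realM of_real_sqr rnormE; congr (_ * _).
  have bC := tagged_partition_borel bK tp j.
  rewrite of_real_sqr rnormE hilbertH -[RHS](pvm_projection pvmE bC.1 bC.2).2.
  by rewrite (pvm_idem pvmE).
rewrite -of_realB -rnorm_lt rnorm_real.
have sv : `|rnorm s - N| <= rnorm (s - v).
  rewrite ler_norml; apply/andP; split.
    by have := rnormD (v - s) s; rewrite subrK rnormBC -/N; lra.
  by have := rnormD (s - v) v; rewrite subrK -/N; lra.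
rewrite -/N subr_sqr normrM.
have N0 : 0 <= N := rnorm_ge0 v; have s0 : 0 <= rnorm s := rnorm_ge0 s.
rewrite [X in _ * X]ger0_norm ?addr_ge0 //.
have := ler_norm (rnorm s - N); have := normr_ge0 (rnorm s - N).
by have := rnorm_ge0 (s - v); nra.
Qed.

End VectorIntegral.

(** * Integrals of step functions *)

Section StepIntegral.
Context {R : realType} {k : scalar_kind}.
Local Notation F := (scalar_field R k).
Context {H : completeNormedModType F} (ip : {dot H for scalar_conj R k}).
Hypothesis hilbertH : is_hilbert ip.
Context (S : set R) (closedS : closed S) (E : set R -> {linear H -> H}).
Hypothesis pvmE : projection_valued_measure ip S E.
Hypothesis diagE : forall x, exists m : {measure set (measurableTypeR R) -> \bar R},
  is_diag_measure ip S E x m.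
Local Notation borel_in := (borel_in S).
Local Notation T := (truncation S).
Local Notation vector_integral := (vector_integral E).
Let mS : measurable S := closed_measurable closedS.
Let bT n : borel_in (T n) := borel_in_truncation mS n.

Definition indicator (J : set R) (t : R) : F := (`[< J t >])%:R.

(* Near a the error is the measure of a punctured neighbourhood of a, which the gauge at a makes
   small. *)
Lemma vector_integral_locally_constant K x (J : set R) (a : R) : borel_in K -> measurable J ->
  (forall t, t != a -> exists2 r : R, 0 < r & forall s, t - r < s < t + r -> (J s <-> J t)) ->
  vector_integral K x (indicator J) (E (K `&` J) x).
Proof.
move=> bK mJ Jloc e e0.
have [r0 r00 hr0] := pvm_punctured hilbertH mS pvmE diagE a x e0.
have /choice[ga gaP] t : exists r : R, [/\ 0 < r, t = a -> r = r0 &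
    t != a -> forall s, t - r < s < t + r -> (J s <-> J t)].
  have [ta|ta] := eqVneq t a; first by exists r0; split.
  by have [r r0' h] := Jloc t ta; exists r; split => // ta'; rewrite ta' eqxx in ta.
exists ga => [t _|n t C tp fine]; first by case: (gaP t).
have bC := tagged_partition_borel bK tp.
have bCJ j : borel_in (C j `&` J) := borel_inI (bC j) mJ.
have [_ UC tC tagC] := tp.
have UCJ : K `&` J = \bigcup_j (C j `&` J) by rewrite -UC setI_bigcupl.
have tCJ : trivIset setT (fun j => C j `&` J).
  by move=> i j _ _ [u [[Ci _] [Cj _]]]; apply: tC => //; exists u.
rewrite UCJ (pvm_bigcup pvmE) // -sumrB.
(* The error of cell j. It vanishes when the tag is not a, since a fine cell stays where J is
   constant, and at most one cell is tagged by a. *)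
pose d j := indicator J (t j) *: E (C j) x - E (C j `&` J) x.
have d0 j : t j != a -> d j = 0.
  move=> ta; have [_ _ /(_ ta) Jta] := gaP (t j); rewrite /d /indicator.
  case: asboolP => Jt.
    rewrite scale1r (_ : C j `&` J = C j) ?subrr //; apply/setIidl => u Cu.
    by apply/(Jta u (fine j u Cu)).
  rewrite scale0r (_ : C j `&` J = set0) ?(pvm_set0 pvmE) ?subr0 //.
  by apply/seteqP; split => // u [Cu Ju]; apply: Jt; apply/(Jta u (fine j u Cu)).
have da j : t j = a -> rnorm (d j) < e.
  move=> ta; apply: le_lt_trans hr0; have [_ /(_ ta) gar0 _] := gaP (t j).
  have sub u : C j u -> u <> a -> (S `&` (`]a - r0, a + r0[%classic `\ a)) u.
    move=> Cu ua; split; first exact: (bC j).2.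
    by split => //=; rewrite in_itv /= -ta -gar0; exact: (fine j u Cu).
  have bP : borel_in (S `&` (`]a - r0, a + r0[%classic `\ a)).
    apply: borel_inI; first exact: borel_inS.
    by apply: measurableD => //; exact: measurable_itv.
  rewrite /d /indicator ta; case: asboolP => Jt.
    have bCD : borel_in (C j `\` J) by exact: borel_inD.
    rewrite scale1r -{1}(setDUK (@subIsetl _ (C j) J)) setDIr setDv set0U.
    rewrite (pvmU pvmE) //; last by apply/seteqP; split => // u [[_ Ju] [_ nJu]].
    rewrite addrAC subrr add0r.
    apply: (pvm_rnorm_sub hilbertH pvmE) => // u [Cu nJu]; apply: sub => // ua.
    by apply: nJu; rewrite ua.
  rewrite scale0r sub0r rnormN.
  apply: (pvm_rnorm_sub hilbertH pvmE) => // u [Cu Ju]; apply: sub => // ua.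
  by apply: Jt; rewrite -ua.
have [[j0 ta]|noa] := pselect (exists j, t j = a).
  rewrite (bigD1 j0) //= big1 ?addr0 => [|j jj0]; first exact: da.
  apply: (d0 j); apply: contraNN jj0 => /eqP tja; apply/eqP/tagC.
  by rewrite ta -tja; apply/tagC.
rewrite big1 ?rnorm0 // => j _; apply: (d0 j); apply/eqP => tja; apply: noa; exists j.
exact: tja.
Qed.

Definition finite_itv (J : set R) :=
  exists (b1 b2 : bool) (a1 a2 : R), J = [set` Interval (BSide b1 a1) (BSide b2 a2)].

Lemma vector_integral_itv K x (J : set R) : borel_in K -> finite_itv J ->
  vector_integral K x (indicator J) (E (K `&` J) x).
Proof.
move=> bK [b1 [b2 [a1 [a2 JE]]]].
pose hl (b : bool) (a : R) := [set` Interval -oo%O (BSide b a)].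
have mh b a : measurable (hl b a) by exact: measurable_itv.
have bh b a : borel_in (K `&` hl b a) := borel_inI bK (mh b a).
have half b a : vector_integral K x (indicator (hl b a)) (E (K `&` hl b a) x).
  apply: (@vector_integral_locally_constant _ _ _ a) => // t ta.
  move: ta; rewrite neq_lt => /orP[] ta; [exists (a - t) | exists (t - a)];
    rewrite ?subr_gt0 // => s /andP[h1 h2]; rewrite /hl /=.
    by case: b; rewrite !in_itv /=; split => h; lra.
  by case: b; rewrite !in_itv /=; split => h; lra.
(* An interval is a difference of two half-lines, each of whose indicators jumps at a single
   point. *)
have JD : J = hl b2 a2 `\` hl b1 a1.
  have memE t : (t \in Interval (BSide b1 a1) (BSide b2 a2)) =
      (t \in Interval -oo%O (BSide b2 a2)) && ~~ (t \in Interval -oo%O (BSide b1 a1)).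
    by case: (b1) (b2) => -[]; rewrite !in_itv /= -?leNgt -?ltNge andbC.
  rewrite JE /hl; apply/seteqP; split => t /=; rewrite memE.
    by move=> /andP[h /negP].
  by move=> [-> /negP ->].
have mJ : measurable J by rewrite JD; exact: measurableD.
have [sub|nsub] := pselect (hl b1 a1 `<=` hl b2 a2).
  have := vector_integral_linear (-1) bK (half b1 a1) (half b2 a2).
  rewrite scaleN1r addrC -[in E (K `&` hl b2 a2) x](setDUK sub) -JD.
  rewrite setIUr (pvmU pvmE) //; last 2 first.
  - exact: borel_inI.
  - by rewrite JD; apply/seteqP; split => // t [[_ h1] [_ [_]]].
  rewrite addrAC subrr add0r; apply: vector_integral_ext => t _.
  rewrite /indicator mulN1r JD.
  case: asboolP => h1; case: asboolP => h2; case: asboolP => h3;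
    rewrite ?oppr0 ?addNr ?add0r //.
  - by case: h3.
  - by case: h2; exact: sub.
  - by case: h2; exact: sub.
  - by case: h3; split.
  - by case: h3 => /h2.
(* Half-lines are nested one way or the other; without the first inclusion J is empty and its
   integral is 0. *)
have down b a u t : u <= t -> hl b a t -> hl b a u.
  by rewrite /hl /=; case: b; rewrite !in_itv /=; [exact: le_lt_trans | exact: le_trans].
have J0 : J = set0.
  rewrite JD; apply/seteqP; split => // u [h2 h1]; apply: nsub => t t1.
  apply: contrapT => t2; have [ut|tu] := leP u t; first exact/h1/(down _ _ _ _ ut).
  exact/t2/(down _ _ _ _ (ltW tu)).
rewrite J0 setI0 (pvm_set0 pvmE); apply: vector_integral_ext (vector_integral0 E K x) => t _.
by rewrite /indicator; case: asboolP.
Qed.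

Definition step_approx (K : set R) (f : R -> F) (e : R) (I : finType) (w : I -> F)
    (J : I -> set R) : Prop :=
  [/\ forall i, finite_itv (J i), forall t, K t -> exists i, J i t,
      trivIset setT (fun i => K `&` J i) &
      forall i t, K t -> J i t -> rnorm (f t - w i) <= e].

Lemma finite_itv_measurable J : finite_itv J -> measurable J.
Proof. by move=> [b1 [b2 [a1 [a2 ->]]]]; exact: measurable_itv. Qed.

Lemma step_approxS K K' f e (I : finType) w (J : I -> set R) : K' `<=` K ->
  step_approx K f e w J -> step_approx K' f e w J.
Proof.
move=> KK' [Jitv KJ tJ fw]; split => // [t /KK'/KJ //|i j _ _ [t [[Kt Ji] [_ Jj]]]|i t /KK'].
  by apply: tJ => //; exists t; do 2!split => //; exact: KK'.
exact: fw.
Qed.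

Section Step.
Context (n : nat) (f : R -> F) (e : R) (I : finType) (w : I -> F) (J : I -> set R).
Hypothesis stepJ : step_approx (T n) f e w J.

Lemma step_borel i : borel_in (T n `&` J i).
Proof. by apply: borel_inI => //; apply: finite_itv_measurable; case: stepJ. Qed.

Lemma step_cover : \bigcup_i (T n `&` J i) = T n.
Proof.
have [_ KJ _ _] := stepJ; apply/seteqP; split => [t [i _ []]//|t Tt].
by have [i Ji] := KJ t Tt; exists i.
Qed.

Lemma vector_integral_step x :
  vector_integral (T n) x (fun t => \sum_i w i * indicator (J i) t)
    (\sum_i w i *: E (T n `&` J i) x).
Proof.
by apply: vector_integral_sum => // i; apply: vector_integral_itv => //; case: stepJ.
Qed.

Lemma step_close t : T n t -> rnorm (f t - \sum_i w i * indicator (J i) t) <= e.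
Proof.
move=> Tt; have [_ KJ tJ fw] := stepJ; have [i Ji] := KJ t Tt.
rewrite (bigD1 i) //= big1 => [|j ji].
  by rewrite addr0 /indicator; case: asboolP => // _; rewrite mulr1; exact: fw.
rewrite /indicator; case: asboolP => [Jj|]; last by rewrite mulr0.
by move: ji; rewrite (tJ j i Logic.I Logic.I) ?eqxx //; exists t.
Qed.

Lemma vector_integral_step_close x v : 0 <= e -> vector_integral (T n) x f v ->
  rnorm (v - \sum_i w i *: E (T n `&` J i) x) <= e * rnorm x.
Proof.
move=> e0 hv.
have := vector_integral_linear (-1) (bT n) (vector_integral_step x) hv.
rewrite scaleN1r addrC; apply: (vector_integral_le hilbertH closedS pvmE) => // t Tt.
by rewrite mulN1r addrC; exact: step_close.
Qed.

End Step.

End StepIntegral.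

(** * Step approximation of regulated functions *)

Section Regulated.
Context {R : realType} {k : scalar_kind}.
Local Notation F := (scalar_field R k).
Implicit Types (S : set R) (f : R -> F).

Lemma near_left S (c : R) (P : R -> Prop) : (\forall s \near within S c^'-, P s) ->
  exists2 r : R, 0 < r & forall s, S s -> c - r < s < c -> P s.
Proof.
rewrite /at_left near_withinE near_withinE => /nbhs_ballP[r /= r0 h].
exists r => // s Ss /andP[cs sc]; apply: h => //.
by rewrite -ball_normE /= ltr_norml; apply/andP; lra.
Qed.

Lemma near_right S (c : R) (P : R -> Prop) : (\forall s \near within S c^'+, P s) ->
  exists2 r : R, 0 < r & forall s, S s -> c < s < c + r -> P s.
Proof.
rewrite /at_right near_withinE near_withinE => /nbhs_ballP[r /= r0 h].
exists r => // s Ss /andP[cs sc]; apply: h => //.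
by rewrite -ball_normE /= ltr_norml; apply/andP; lra.
Qed.

Lemma cvg_scalarP (G : set_system R) (FG : Filter G) f (l : F) (e : R) :
  f @ G --> l -> 0 < e -> \forall s \near G, rnorm (f s - l) < e.
Proof.
move=> /cvgrPdist_lt h e0; have := h (of_real k e).
rewrite -(@of_real0 R k) of_real_lt => /(_ e0).
by apply: filterS => s; rewrite -rnorm_lt rnormBC.
Qed.

Lemma regulated_osc S f (c e : R) : regulated S f -> S c -> 0 < e ->
  exists r wl wr, [/\ 0 < r,
    forall s, S s -> c - r < s < c -> rnorm (f s - wl) <= e &
    forall s, S s -> c < s < c + r -> rnorm (f s - wr) <= e].
Proof.
move=> fR Sc e0; have [/cvg_ex[wl hl] /cvg_ex[wr hr]] := fR c Sc.
have [r1 r10 h1] := near_left (cvg_scalarP _ hl e0).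
have [r2 r20 h2] := near_right (cvg_scalarP _ hr e0).
exists (Num.min r1 r2), wl, wr; split; first by rewrite lt_min r10.
- move=> s Ss /andP[cs sc]; apply/ltW/h1 => //; rewrite sc andbT.
  by apply: le_lt_trans cs; rewrite lerB // ge_min lexx.
- move=> s Ss /andP[cs sc]; apply/ltW/h2 => //; rewrite cs /=.
  by apply: lt_le_trans sc _; rewrite lerD2l ge_min lexx orbT.
Qed.

(* The cells of a tagged partition that is fine for the gauge of [regulated_osc], cut at their
   tags. *)
Lemma regulated_step S f (n : nat) (e : R) : closed S -> regulated S f -> 0 < e ->
  exists (I : finType) (w : I -> F) (J : I -> set R),
    step_approx (truncation S n) f e w J /\
    forall i, (exists a b, truncation S n `&` J i `<=` `]a, b[%classic /\
                 forall s, S s -> a < s < b -> rnorm (f s - w i) <= e) \/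
              (exists c, [/\ S c, truncation S n `&` J i `<=` [set c] & w i = f c]).
Proof.
move=> closedS fR e0; set K := truncation S n.
(* The triple g(t) holds a radius and the approximate values of f to the left and to the right of t;
   off S it is a dummy. *)
have /choice[g gP] t : exists g : R * (F * F), S t -> [/\ 0 < g.1,
    forall s, S s -> t - g.1 < s < t -> rnorm (f s - g.2.1) <= e &
    forall s, S s -> t < s < t + g.1 -> rnorm (f s - g.2.2) <= e].
  have [St|nSt] := pselect (S t); last by exists (0, (0, 0)) => /nSt.
  by have [r [wl [wr h]]] := regulated_osc fR St e0; exists (r, (wl, wr)).
have gg : gauge K (fun t => (g t).1) by move=> t [/gP[]].
have [m [t [C [tp fine]]]] := truncation_cousin closedS gg.
have [[p _ cellC] UC tC tagC] := tp.
have /choice[c cP] j : exists c : (bool * R) * (bool * R),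
    C j = K `&` [set` Interval (BSide c.1.1 c.1.2) (BSide c.2.1 c.2.2)].
  by have [i [b1 [b2 [_ ->]]]] := cellC j; exists ((b1, p`_i), (b2, p`_i.+1)).
have Ct j : C j (t j) by apply/tagC.
have St j : S (t j) by have := Ct j; rewrite cP => -[[]].
(* Each cell is cut into its parts left of the tag ([Some true]), at the tag ([None]) and right of
   it ([Some false]), because f may jump at the tag. *)
pose J (i : 'I_m * option bool) : set R := let j := i.1 in
  match i.2 with
  | None => [set` Interval (BSide true (t j)) (BSide false (t j))]
  | Some true => [set` Interval (BSide (c j).1.1 (c j).1.2) (BSide true (t j))]
  | Some false => [set` Interval (BSide false (t j)) (BSide (c j).2.1 (c j).2.2)]
  end.
pose w (i : 'I_m * option bool) : F := let j := i.1 in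
  match i.2 with
  | None => f (t j) | Some true => (g (t j)).2.1 | Some false => (g (t j)).2.2 end.
have side j o s : J (j, o) s ->
    match o return Prop with None => s = t j | Some true => s < t j | Some false => t j < s end.
  rewrite /J /=; case: o => [[]|] /=.
  - by case: (c j).1.1; rewrite in_itv /= => /andP[].
  - by case: (c j).2.1; rewrite in_itv /= => /andP[].
  - by rewrite in_itv /= => /andP[h1 h2]; apply/le_anti; rewrite h1 h2.
have JC i : K `&` J i `<=` C i.1.
  case: i => j o s [Ks]; have := Ct j; rewrite /J cP /=.
  case: (c j) => -[b1 a1] [b2 a2] /= [_ tj] Js; split => //; move: tj Js.
  by case: o => [[]|]; case: b1; case: b2; rewrite /= !in_itv /= =>
    /andP[h1 h2] /andP[h3 h4]; apply/andP; lra.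
exists ('I_m * option bool)%type, w, J; split; first split.
- by case=> j [[]|]; rewrite /J; do 4!eexists.
- move=> s; rewrite /K -UC => -[j _ Cs].
  have := Cs; rewrite cP => -[_ /= Js].
  have [st|st|st] := ltgtP s (t j); [exists (j, Some true) | exists (j, Some false) |
    by exists (j, None); rewrite /J /= in_itv /= st lexx].
    rewrite /J /=; move: Js; case: (c j) => -[b1 a1] [b2 a2] /=.
    by case: b1; rewrite !in_itv /= => /andP[-> _].
  rewrite /J /=; move: Js; case: (c j) => -[b1 a1] [b2 a2] /=.
  by case: b1; case: b2; rewrite !in_itv /= st => /andP[_ ->].
- move=> [i o] [j o'] _ _ [s [Ks Ks']].
  have /= Ci := JC _ _ Ks; have /= Cj := JC _ _ Ks'.
  have ij : i = j by apply: tC => //; exists s.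
  subst j; congr (_, _); have := side _ _ _ Ks.2; have := side _ _ _ Ks'.2.
  by case: o o' {Ks Ks'} => [[]|] [[]|] // h1 h2; exfalso; lra.
- move=> [j o] s Ks Js; have := fine j s (JC _ _ (conj Ks Js)).
  have [_ hl hr] := gP _ (St j); have := side _ _ _ Js; rewrite /w /=.
  case: o Js => [[]|] Js /= h /andP[h1 h2].
  + by apply: hl; [exact: Ks.1 | rewrite h1].
  + by apply: hr; [exact: Ks.1 | rewrite h].
  + by rewrite h subrr rnorm0 ltW.
- case=> j o; have [_ hl hr] := gP _ (St j).
  have fineJ s : (K `&` J (j, o)) s -> t j - (g (t j)).1 < s < t j + (g (t j)).1.
    by move=> /JC; exact: fine.
  case: o fineJ => [[]|] fineJ; rewrite /w /=; [left|left|right].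
  + exists (t j - (g (t j)).1), (t j); split => // s Ks /=; rewrite in_itv /=.
    by have /andP[-> _] := fineJ s Ks; exact: side _ _ _ Ks.2.
  + exists (t j), (t j + (g (t j)).1); split => // s Ks /=; rewrite in_itv /=.
    by have /andP[_ ->] := fineJ s Ks; rewrite andbT; exact: side _ _ _ Ks.2.
  + by exists (t j); split => // s Ks; exact: side _ _ _ Ks.2.
Qed.

End Regulated.

(** * The truncated integrals [D n x] of f against E, and operators determined by them *)

Section FunctionalCalculus.
Context {R : realType} {k : scalar_kind}.
Local Notation F := (scalar_field R k).
Context {H : completeNormedModType F} (ip : {dot H for scalar_conj R k}).
Hypothesis hilbertH : is_hilbert ip.
Context (S : set R) (closedS : closed S) (E : set R -> {linear H -> H}).
Hypothesis pvmE : projection_valued_measure ip S E.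
Hypothesis diagE : forall x, exists m : {measure set (measurableTypeR R) -> \bar R},
  is_diag_measure ip S E x m.
Context (f : R -> F) (fR : regulated S f).
Local Notation borel_in := (borel_in S).
Local Notation T := (truncation S).
Let mS : measurable S := closed_measurable closedS.
Let bT n : borel_in (T n) := borel_in_truncation mS n.

Lemma regulated_vector_integral n x : exists v, vector_integral E (T n) x f v.
Proof.
apply: (vector_integral_uniform hilbertH closedS pvmE) => e e0.
have [I [w [J [stepJ _]]]] := regulated_step n closedS fR e0.
exists (fun t => \sum_i w i * indicator (J i) t), (\sum_i w i *: E (T n `&` J i) x); split.
  exact: step_close stepJ.
exact: (vector_integral_step hilbertH closedS pvmE diagE stepJ).
Qed.

Lemma rnorm_small_eq0 (V : normedZmodType F) (y : V) (c : R) :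
  (forall e, 0 < e -> rnorm y <= e * c) -> y = 0.
Proof.
move=> h; apply/rnorm_le0/ler_addgt0Pr => e e0; rewrite add0r.
have c1 : 0 < `|c| + 1 by have := normr_ge0 c; lra.
apply: le_trans (h _ (divr_gt0 e0 c1)) _; rewrite mulrAC ler_pdivrMr //.
by have := ler_norm c; nra.
Qed.

Context (D : nat -> H -> H) (DP : forall n x, vector_integral E (T n) x f (D n x)).

Lemma integral_linear n (a : F) x y : D n (a *: x + y) = a *: D n x + D n y.
Proof.
apply: (vector_integral_unique closedS) (DP _ _) _.
exact: vector_integral_linearr (bT n) (DP n x) (DP n y).
Qed.

Lemma integral_pvm n B x : borel_in B -> D n (E B x) = E B (D n x).
Proof.
move=> bB; apply: (vector_integral_unique closedS) (DP _ _) _.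
exact: (vector_integral_pvm hilbertH pvmE (bT n)).
Qed.

Lemma integral_step n e (I : finType) w (J : I -> set R) x : 0 <= e ->
  step_approx (T n) f e w J ->
  rnorm (D n x - \sum_i w i *: E (T n `&` J i) x) <= e * rnorm x.
Proof. by move=> e0 st; exact: (vector_integral_step_close hilbertH closedS pvmE diagE st). Qed.

Lemma step_trivIset n e (I : finType) (w : I -> F) J : step_approx (T n) f e w J ->
  trivIset setT (fun i => T n `&` J i).
Proof. by case. Qed.

Lemma step_sub n e (I : finType) (w : I -> F) J x (l : F) : step_approx (T n) f e w J ->
  \sum_i w i *: E (T n `&` J i) x - l *: E (T n) x = \sum_i (w i - l) *: E (T n `&` J i) x.
Proof.
move=> st; rewrite -{2}(step_cover st) (pvm_bigcup pvmE); last 2 first.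
- exact: step_borel st.
- exact: step_trivIset st.
by rewrite scaler_sumr -sumrB; apply: eq_bigr => i _; rewrite scalerBl.
Qed.

Lemma integral_bounded n : exists2 c : R, 0 <= c & forall x, rnorm (D n x) <= c * rnorm x.
Proof.
have [I [w [J [st _]]]] := regulated_step n closedS fR ltr01.
exists (1 + \sum_i rnorm (w i)).
  by rewrite addr_ge0 // sumr_ge0 // => i _; exact: rnorm_ge0.
move=> x; have := integral_step x ler01 st; set s := \sum_i _ *: _ => h.
have : rnorm s <= (\sum_i rnorm (w i)) * rnorm x.
  apply: (pvm_step_le hilbertH pvmE) => //.
  - exact: step_borel st.
  - exact: step_trivIset st.
  - by rewrite sumr_ge0 // => i _; exact: rnorm_ge0.
  - by move=> i _; rewrite (bigD1 i) //= lerDl sumr_ge0 // => j _; exact: rnorm_ge0.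
have := rnormD (D n x - s) s; rewrite subrK mulrDl; lra.
Qed.

(** A step approximation on T_m restricts to one on T_n, and both integrals are close to the same
    finite sum. *)
Lemma integral_truncation n m x : (n <= m)%N -> D m (E (T n) x) = D n x.
Proof.
move=> nm; apply/eqP; rewrite -subr_eq0; apply/eqP.
apply: (@rnorm_small_eq0 _ _ (2 * rnorm x)) => e e0.
have [I [w [J [st _]]]] := regulated_step m closedS fR e0.
have stn := step_approxS (truncationS nm) st.
have := integral_step (E (T n) x) (ltW e0) st; have := integral_step x (ltW e0) stn.
rewrite (_ : \sum_i w i *: E (T m `&` J i) (E (T n) x) = \sum_i w i *: E (T n `&` J i) x).
  set s := \sum_i _ => h1 h2; apply: le_trans (rnorm_tri s _ _) _; rewrite (rnormBC s).
  have := pvm_rnorm_le hilbertH pvmE x (bT n); nra.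
apply: eq_bigr => i _; rewrite (pvmI pvmE) //; last exact: (step_borel closedS st).
by rewrite setIAC (setIidr (truncationS nm)).
Qed.

(** Only pieces that meet B charge x, and a common point t of such a piece and B puts the step value
    within e of f(t) and f(t) within d of w0. *)
Lemma integral_local n B x (w0 : F) (d : R) : borel_in B -> B `<=` T n -> E B x = x ->
  (forall t, B t -> rnorm (f t - w0) <= d) -> 0 <= d ->
  rnorm (D n x - w0 *: x) <= d * rnorm x.
Proof.
move=> bB BT Bx fB d0; apply/ler_addgt0Pr => e0 e00.
have x1 : 0 < 2 * (rnorm x + 1) by have := rnorm_ge0 x; lra.
pose e := e0 / (2 * (rnorm x + 1)); have e1 : 0 < e by rewrite divr_gt0.
have [I [w [J [st _]]]] := regulated_step n closedS fR e1.
have Tx : E (T n) x = x by rewrite -Bx (pvm_subr pvmE).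
have := integral_step x (ltW e1) st; set s := \sum_i _ => h1.
have h2 : rnorm (s - w0 *: x) <= (d + e) * rnorm x.
  rewrite -{1}Tx (step_sub _ _ st); apply: (pvm_step_le hilbertH pvmE).
  - exact: step_borel st.
  - exact: step_trivIset st.
  - by rewrite addr_ge0 // ltW.
  move=> i Ex; have [t [[Tt Jt] Bt]] : ((T n `&` J i) `&` B) !=set0.
    apply/set0P/eqP => JB0; move/eqP: Ex; apply.
    rewrite -Bx (pvmI pvmE) //; last exact: (step_borel closedS st).
    by rewrite JB0 (pvm_set0 pvmE).
  have [_ _ _ /(_ i t Tt Jt) fw] := st; have := fB t Bt.
  by have := rnorm_tri (f t) (w i) w0; rewrite (rnormBC (w i) (f t)); lra.
apply: le_trans (rnorm_tri s _ _) _.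
have : e * (2 * (rnorm x + 1)) = e0 by rewrite /e divfK // gt_eqF.
by nra.
Qed.

(** From here to the end of the section [A] stands for f(A), not for the self-adjoint operator. The
    two hypotheses hold in the bounded and in the unbounded case alike. *)
Context (A : operator H).
Hypothesis Adom : forall x, (exists M, forall n, rnorm (D n x) <= M) -> dom A x.
Hypothesis Atrunc : forall x n, dom A x -> E (T n) (A x) = D n x.

Lemma truncation_limit_eq x y : (\forall n \near \oo, E (T n) x = y) -> x = y.
Proof.
move=> xy; have h : E (T n) x @[n --> \oo] --> x.
  exact: (pvm_truncation_cvg hilbertH mS pvmE diagE).
by rewrite -(cvg_lim _ h) //; apply: cvg_lim => //; exact: cvg_near_cst.
Qed.

(** For such x the sequence D_m(x) is constant from m = n on, and D_m(x) = E(T_m) D_n(x) before, so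
    it is bounded. *)
Lemma fcalc_truncation n x : E (T n) x = x -> dom A x /\ A x = D n x.
Proof.
move=> nx.
have Dm m : (n <= m)%N -> D m x = D n x by move=> nm; rewrite -{1}nx integral_truncation.
have dx : dom A x.
  apply: Adom; exists (rnorm (D n x)) => m.
  have [nm|/ltnW mn] := leqP n m; first by rewrite Dm.
  by rewrite -(integral_truncation x mn) integral_pvm // (pvm_rnorm_le hilbertH pvmE).
split=> //; apply: truncation_limit_eq; exists n => // m /= nm.
by rewrite Atrunc // Dm.
Qed.

(** Each D_n is bounded, so E(T_n) f(A)u = D_n(u) passes to the limit and gives D_n(x) = E(T_n)z,
    which is bounded by |z| uniformly in n. *)
Lemma fcalc_closed_graph : closed_graph A.
Proof.
move=> u x z du ux Auz.
have Dx n : D n x = E (T n) z.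
  have [c c0 Dc] := integral_bounded n.
  apply/eqP; rewrite -subr_eq0; apply/eqP/(@rnorm_small_eq0 _ _ (c + 1)) => e e0.
  have /filterI/(_ ((cvg_rnormP _ _).1 Auz _ e0)) := (cvg_rnormP _ _).1 ux _ e0.
  move=> -[p _ /(_ p (leqnn p)) [/= h1 h2]].
  apply: le_trans (rnorm_tri (D n (u p)) _ _) _.
  have DB : D n x - D n (u p) = D n (x - u p).
    by have := integral_linear n (-1) (u p) x; rewrite !scaleN1r !(addrC (- _)).
  rewrite DB -(Atrunc n (du p)) -linearB.
  have := Dc (x - u p); have := pvm_rnorm_le hilbertH pvmE (A (u p) - z) (bT n).
  rewrite (rnormBC x); nra.
have dx : dom A x.
  by apply: Adom; exists (rnorm z) => n; rewrite Dx (pvm_rnorm_le hilbertH pvmE).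
split=> //; apply/eqP; rewrite -subr_eq0; apply/eqP; apply: truncation_limit_eq.
by exists 0%N => // n _ /=; rewrite linearB Atrunc // Dx subrr.
Qed.

End FunctionalCalculus.

(** * The spectrum of f(A) as the closure of the essential values of f *)

Section SpectralMapping.
Context {R : realType} {k : scalar_kind}.
Local Notation F := (scalar_field R k).
Local Notation "a %:F" := (of_real k a).
Context {H : completeNormedModType F} (ip : {dot H for scalar_conj R k}).
Hypothesis hilbertH : is_hilbert ip.
Local Notation rip := (rip ip).
Context (A : operator H) (saA : self_adjoint ip A).
Context (E : set R -> {linear H -> H}) (EA : spectral_measure_of ip A E).
Local Notation S := (rspectrum A).
Context (f : R -> F) (fR : regulated S f).
Local Notation borel_in := (borel_in S).
Local Notation T := (truncation S).
Let closedS : closed S := rspectrum_closed hilbertH saA.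
Let mS : measurable S := closed_measurable closedS.
Let bT n : borel_in (T n) := borel_in_truncation mS n.
Let pvmE := EA.1.
Let diagE := spectral_diag EA.

Definition value_set : set F :=
  (f @` rpoint_spectrum A) `|` one_sided_limits S (S `\` rpoint_spectrum A) f.

Lemma limit_value_le (a b e : R) (w l : F) (G : set_system R) (FG : Filter G) :
  f @ G --> l ->
  (forall P : R -> Prop, (\forall s \near G, P s) -> exists2 s, P s & S s /\ a < s < b) ->
  (forall s, S s -> a < s < b -> rnorm (f s - w) <= e) -> rnorm (w - l) <= e.
Proof.
move=> fl Gs fw; apply/ler_addgt0Pr => e' e'0.
have [s /= h1 [Ss sab]] := Gs _ (cvg_scalarP FG fl e'0).
have := rnorm_tri (f s) w l; rewrite (rnormBC w (f s)); have := fw s Ss sab; lra.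
Qed.

(* A point of S outside the point spectrum has E-measure zero, so it is an accumulation point
   of S. *)
Lemma value_set_near (a b e s0 : R) (w : F) : 0 <= e -> S s0 -> a < s0 < b ->
  (forall s, S s -> a < s < b -> rnorm (f s - w) <= e) ->
  exists2 w', value_set w' & rnorm (w - w') <= e.
Proof.
move=> e0 Ss0 sab fw; have [ps0|nps0] := pselect (rpoint_spectrum A s0).
  exists (f s0); first by left; exists s0.
  by rewrite rnormBC; exact: fw.
(* If s0 were isolated in S, the nonzero range of E on a small window would be that of E({s0}),
   making s0 an eigenvalue. *)
have accum (r : R) : 0 < r -> exists s, [/\ S s, s != s0 & s0 - r < s < s0 + r].
  move=> r0; apply: contrapT => nos; apply: nps0.
  have [x [x0 Bx]] := rspectrum_support hilbertH saA EA Ss0 r0.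
  have sub : S `&` `]s0 - r, s0 + r[%classic `<=` [set s0].
    move=> s [Ss /=]; rewrite in_itv /= => sr; apply: contrapT => /eqP ss0.
    by apply: nos; exists s.
  have s0x : E [set s0] x = x.
    rewrite -Bx (pvm_subr pvmE) //; last exact: borel_in1.
    exact: borel_in_itv.
  by have [dx Ax] := eigenvector_of_atom hilbertH saA EA Ss0 s0x; exists x.
have [/cvg_ex[wl hl] /cvg_ex[wr hr]] := fR Ss0.
have /andP[as0 s0b] := sab.
have [left_acc|] := pselect (forall r : R, 0 < r -> exists s, S s /\ s0 - r < s < s0).
  exists wl.
    right; exists s0 => //; left; split => // U /nbhs_ballP[r /= r0 rU].
    have [s [Ss /andP[h1 h2]]] := left_acc r r0; exists s; split.
    - by rewrite lt_eqF.
    - by split => //=; rewrite in_itv.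
    - by apply: rU; rewrite -ball_normE /= gtr0_norm ?subr_gt0 //; lra.
  apply: (limit_value_le _ hl _ fw) => P /near_left[r r0 hP].
  have [|s [Ss /andP[h1 h2]]] := left_acc (Num.min r (s0 - a)).
    by rewrite lt_min r0 subr_gt0.
  have m1 : Num.min r (s0 - a) <= r by rewrite ge_min lexx.
  have m2 : Num.min r (s0 - a) <= s0 - a by rewrite ge_min lexx orbT.
  move: m1 m2 h1; move: (Num.min _ _) => m m1 m2 h1.
  by exists s; [apply: hP => //; apply/andP; lra | split => //; apply/andP; lra].
move=> nleft; have right_acc (q : R) : 0 < q -> exists s, S s /\ s0 < s < s0 + q.
  have [r1 [r10 nr1]] : exists r : R, 0 < r /\ ~ exists s, S s /\ s0 - r < s < s0.
    apply: contrapT => no; apply: nleft => r r0; apply: contrapT => nos.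
    by apply: no; exists r.
  move=> q0; have [|s [Ss ss0 /andP[h1 h2]]] := accum (Num.min q r1).
    by rewrite lt_min q0.
  have m1 : Num.min q r1 <= q by rewrite ge_min lexx.
  have m2 : Num.min q r1 <= r1 by rewrite ge_min lexx orbT.
  move: m1 m2 h1 h2; move: (Num.min _ _) => m m1 m2 h1 h2.
  exists s; split => //; move: ss0; rewrite neq_lt => /orP[ss0|->]; last by rewrite /=; lra.
  by exfalso; apply: nr1; exists s; split => //; apply/andP; lra.
exists wr.
  right; exists s0 => //; right; split => // U /nbhs_ballP[r /= r0 rU].
  have [s [Ss /andP[h1 h2]]] := right_acc r r0; exists s; split.
  - by rewrite gt_eqF.
  - by split => //=; rewrite in_itv /= h1.
  - by apply: rU; rewrite -ball_normE /= ltr0_norm ?subr_lt0 //; lra.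
apply: (limit_value_le _ hr _ fw) => P /near_right[r r0 hP].
have [|s [Ss /andP[h1 h2]]] := right_acc (Num.min r (b - s0)).
  by rewrite lt_min r0 subr_gt0.
have m1 : Num.min r (b - s0) <= r by rewrite ge_min lexx.
have m2 : Num.min r (b - s0) <= b - s0 by rewrite ge_min lexx orbT.
move: m1 m2 h2; move: (Num.min _ _) => m m1 m2 h2.
by exists s; [apply: hP => //; apply/andP; lra | split => //; apply/andP; lra].
Qed.

(** A piece charging some vector either lies in an open interval on which f is nearly constant and
    meets S there, or lies in some {c}, whose mass makes c an eigenvalue. *)
Lemma step_value_set n (e : R) : 0 < e -> exists (I : finType) (w : I -> F) (J : I -> set R),
  step_approx (T n) f e w J /\
  forall i x, E (T n `&` J i) x != 0 -> exists2 w', value_set w' & rnorm (w i - w') <= e.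
Proof.
move=> e0; have [I [w [J [st wJ]]]] := regulated_step n closedS fR e0.
exists I, w, J; split=> // i x Ex; have bJ := step_borel closedS st i.
case: (wJ i) => [[a [b [Jab fw]]]|[c [Sc Jc wc]]].
  have [s [Ts Js]] : (T n `&` J i) !=set0.
    by apply/set0P/eqP => J0; move: Ex; rewrite J0 (pvm_set0 pvmE) eqxx.
  have := Jab s (conj Ts Js); rewrite /= in_itv /= => sab.
  exact: (value_set_near (ltW e0) Ts.1 sab fw).
exists (f c); last by rewrite wc subrr rnorm0 ltW.
left; exists c => //; exists (E [set c] x).
have bc := borel_in1 Sc.
have [dx Ax] := eigenvector_of_atom hilbertH saA EA Sc (pvm_idem pvmE x bc).
split=> //; apply: contra_neq Ex => Ex0; exact: (pvm_sub_eq0 pvmE bJ bc Jc Ex0).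
Qed.

Context (D : nat -> H -> H) (DP : forall n x, vector_integral E (T n) x f (D n x)).
Context (fA : operator H).
Hypothesis fAdom : forall x, (exists M, forall n, rnorm (D n x) <= M) -> dom fA x.
Hypothesis fAtrunc : forall x n, dom fA x -> E (T n) (fA x) = D n x.

Let trunc_op n x : E (T n) x = x -> dom fA x /\ fA x = D n x :=
  @fcalc_truncation _ _ _ _ hilbertH _ closedS _ pvmE diagE _ fR _ DP _ fAdom fAtrunc n x.

Lemma mem_truncation (M : R) : exists n : nat, forall B, B `<=` S ->
  (forall t, B t -> `|t| <= M) -> B `<=` T n.
Proof.
exists (Num.bound M) => B BS BM t Bt; split; first exact: BS.
rewrite /= in_itv /= -ler_norml; apply: le_trans (BM t Bt) _; apply: le_trans (ler_norm M) _.
by have := archi_boundP (normr_ge0 M); rewrite /Num.bound normr_id => /ltW.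
Qed.

Lemma approx_eigenvector_local (B : set R) x (w : F) (e M : R) : borel_in B -> x != 0 ->
  E B x = x -> (forall t, B t -> `|t| <= M) -> 0 <= e ->
  (forall t, B t -> rnorm (f t - w) <= e) ->
  exists x, [/\ x != 0, dom fA x & rnorm (fA x - w *: x) <= e * rnorm x].
Proof.
move=> bB x0 Bx BM e0 fB; have [n Tn] := mem_truncation M.
have BT := Tn B bB.2 BM.
have Tx : E (T n) x = x by rewrite -Bx (pvm_subr pvmE).
have [dx fAx] := trunc_op Tx; exists x; split=> //; rewrite fAx.
exact: (integral_local hilbertH closedS pvmE diagE fR DP bB BT Bx fB e0).
Qed.

Lemma approx_eigenvector_itv (a b s0 e : R) (w : F) : 0 <= e -> S s0 -> a < s0 < b ->
  (forall s, S s -> a < s < b -> rnorm (f s - w) <= e) ->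
  exists x, [/\ x != 0, dom fA x & rnorm (fA x - w *: x) <= e * rnorm x].
Proof.
(* The symmetric window of radius r around s0 stays inside (a,b) and has nonzero spectral
   projection. *)
move=> e0 Ss0 /andP[as0 s0b] fw; pose r := Num.min (s0 - a) (b - s0).
have r0 : 0 < r by rewrite lt_min !subr_gt0 as0.
have m1 : r <= s0 - a by rewrite ge_min lexx.
have m2 : r <= b - s0 by rewrite ge_min lexx orbT.
have [x [x0 Bx]] := rspectrum_support hilbertH saA EA Ss0 r0.
apply: (approx_eigenvector_local (M := `|s0| + r) _ x0 Bx) => //; first exact: borel_in_itv.
- move=> t [_ /=]; rewrite in_itv /= => /andP[h1 h2].
  have : `|t - s0| <= r by rewrite ler_norml; apply/andP; lra.
  by have := ler_normD (t - s0) s0; rewrite subrK; lra.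
- move=> t [St /=]; rewrite in_itv /= => /andP[h1 h2]; apply: fw => //.
  by apply/andP; clearbody r; lra.
Qed.

Lemma approx_eigenvector (w : F) (e : R) : value_set w -> 0 < e ->
  exists x, [/\ x != 0, dom fA x & rnorm (fA x - w *: x) <= e * rnorm x].
Proof.
move=> [[c pc <-]|[c [Sc _] [[lc fl]|[lc fl]]]] e0.
- have [x [x0 cx]] := atom_of_eigenvalue hilbertH saA EA pc.
  have bc := borel_in1 (rpoint_spectrum_sub pc).
  apply: (approx_eigenvector_local (M := `|c|) bc x0 cx) => // [t -> //||t ->]; first exact: ltW.
  by rewrite subrr rnorm0 ltW.
- have [r r0 fr] := near_left (cvg_scalarP _ fl e0).
  have [s [_ [Ss /=]]] := lc _ (nbhsx_ballx c r r0).
  rewrite -ball_normE /= in_itv /= => sc; rewrite ltr_norml => /andP[h1 h2].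
  apply: (approx_eigenvector_itv (a := c - r) (b := c) (ltW e0) Ss); first by apply/andP; lra.
  by move=> t St tc; apply/ltW/fr.
- have [r r0 fr] := near_right (cvg_scalarP _ fl e0).
  have [s [_ [Ss /=]]] := lc _ (nbhsx_ballx c r r0).
  rewrite -ball_normE /= in_itv /= andbT => sc; rewrite ltr_norml => /andP[h1 h2].
  apply: (approx_eigenvector_itv (a := c) (b := c + r) (ltW e0) Ss); first by apply/andP; lra.
  by move=> t St tc; apply/ltW/fr.
Qed.

Lemma closure_value_set_spectrum : closure value_set `<=` spectrum fA.
Proof.
move=> l cl /bounded_below_of_resolvent[d d0 bb].
(* One third of d goes to the distance from l to a value w, one third to the approximate eigenvector
   for w; the sum is below d. *)
have d2 : 0 < d / 3 by rewrite divr_gt0.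
have d2F : 0 < (d / 3)%:F by rewrite -(@of_real0 R k) of_real_lt.
have [w [Ww]] := cl _ (nbhsx_ballx l _ d2F).
rewrite -ball_normE /= -rnorm_lt => lw.
have [x [x0 dx fAx]] := approx_eigenvector Ww d2.
have xp : 0 < rnorm x.
  by rewrite lt_neqAle rnorm_ge0 andbT eq_sym; apply: contra_neq x0 => /rnorm0_eq0.
have := bb x dx; have := rnorm_tri (w *: x) (fA x) (l *: x).
rewrite -scalerBl rnormZ (rnormBC w); nra.
Qed.

Section Resolvent.
Context (l : F) (d : R) (d0 : 0 < d) (ld : forall w, value_set w -> d <= rnorm (w - l)).

Lemma step_away n (e : R) : 0 < e -> exists (I : finType) (w : I -> F) (J : I -> set R),
  step_approx (T n) f e w J /\
  forall i x, E (T n `&` J i) x != 0 -> d - e <= rnorm (w i - l).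
Proof.
move=> e0; have [I [w [J [st wJ]]]] := step_value_set n e0.
exists I, w, J; split => // i x /wJ[w' Ww' ww']; have := ld Ww'.
by have := rnorm_tri (w i) w' l; rewrite (rnormBC w' (w i)); lra.
Qed.

Lemma integral_bounded_below n u : E (T n) u = u ->
  d / 2 * rnorm u <= rnorm (D n u - l *: u).
Proof.
(* With e = d/4 the step values stay d - d/4 away from l, and replacing the integral by the step sum
   costs another d/4. *)
move=> Tu; have d4 : 0 < d / 4 by rewrite divr_gt0.
have [I [w [J [st wJ]]]] := step_away n d4.
have := integral_step hilbertH closedS pvmE diagE DP u (ltW d4) st.
set s := \sum_i _ => h1.
have h2 : (d - d / 4) * rnorm (E (\bigcup_i (T n `&` J i)) u) <= rnorm (s - l *: E (T n) u).
  rewrite (step_sub closedS pvmE _ _ st); apply: (pvm_step_ge hilbertH pvmE).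
  - exact: (step_borel closedS st).
  - exact: step_trivIset st.
  - by lra.
  - by move=> i /wJ.
rewrite (step_cover st) Tu in h2.
by have := rnorm_tri (D n u) s (l *: u); rewrite (rnormBC s (D n u)); lra.
Qed.

Lemma fcalc_bounded_below x : dom fA x -> d / 2 * rnorm x <= rnorm (fA x - l *: x).
Proof.
move=> dx; have h n : d / 2 * rnorm (E (T n) x) <= rnorm (fA x - l *: x).
  apply: le_trans (pvm_rnorm_le hilbertH pvmE (fA x - l *: x) (bT n)).
  rewrite linearB linearZ /= (fAtrunc n dx).
  rewrite -(integral_truncation hilbertH closedS pvmE diagE fR DP x (leqnn n)).
  by apply: integral_bounded_below; exact: (pvm_idem pvmE).
apply/ler_addgt0Pr => e e0; have de : 0 < e / d by rewrite divr_gt0.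
have Tx : E (T n) x @[n --> \oo] --> x by exact: (pvm_truncation_cvg hilbertH mS pvmE diagE).
have [n _ /(_ n (leqnn n)) /= hn] := (cvg_rnormP _ _).1 Tx _ de.
have := rnorm_tri (E (T n) x) x 0; rewrite !subr0 (rnormBC x) -(ler_pM2l d0) mulrDr.
move: (h n) hn (rnorm_ge0 (E (T n) x - x)); rewrite ltr_pdivlMr //.
by move: (rnorm _) (rnorm _) (rnorm _) (rnorm _) => a1 a2 a3 a4; lra.
Qed.

(* The vector x = sum_i (w_i - l)^-1 E(C_i) y is an approximate preimage of E(T_n) y. *)
Lemma fcalc_range_dense y : (forall x, dom fA x -> rip (fA x - l *: x) y = 0) -> y = 0.
Proof.
move=> orth; apply: (truncation_limit_eq hilbertH closedS pvmE diagE).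
exists 0%N => // n _ /=; set z := E (T n) y.
have d2 : 0 < d / 2 by rewrite divr_gt0.
suff z2 : rnorm z ^+ 2 = 0 by apply: rnorm0_eq0; apply/eqP; rewrite -sqrf_eq0; apply/eqP.
(* For e <= d/2 the step values that matter stay d/2 away from l, so |x| <= (2/d)|y| and the error
   e|x||y| is at most e c. *)
pose c := 2 / d * rnorm y ^+ 2.
have c0 : 0 <= c by rewrite mulr_ge0 ?sqr_ge0 // divr_ge0 // ltW.
suff small e : 0 < e -> e <= d / 2 -> rnorm z ^+ 2 <= e * c.
  apply/le_anti; rewrite sqr_ge0 andbT; apply/ler_addgt0Pr => e' e'0; rewrite add0r.
  have c1 : 0 < c + 1 by lra.
  have m0 : 0 < Num.min (d / 2) (e' / (c + 1)) by rewrite lt_min d2 divr_gt0.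
  apply: le_trans (small _ m0 _) _; first by rewrite ge_min lexx.
  apply: (@le_trans _ _ (e' / (c + 1) * c)); first by rewrite ler_wpM2r // ge_min lexx orbT.
  by rewrite mulrAC ler_pdivrMr // ler_pM2l //; lra.
move=> e0 ed; have [I [w [J [st wJ]]]] := step_away n e0.
pose x := \sum_i (w i - l)^-1 *: E (T n `&` J i) y.
have bJ := step_borel closedS st; have tJ := step_trivIset st.
have Ex i : E (T n `&` J i) x = (w i - l)^-1 *: E (T n `&` J i) y.
  rewrite linear_sum (bigD1 i) //= big1 ?addr0 => [|j ji].
    by rewrite linearZ /= (pvm_idem pvmE).
  rewrite linearZ /= (pvmI pvmE) // (_ : _ `&` _ = set0) ?(pvm_set0 pvmE) ?scaler0 //.
  apply/eqP/negPn/negP => /set0P JJ; move/negP: ji; apply.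
  by rewrite eq_sym; apply/eqP; exact: tJ.
have Tx : E (T n) x = x.
  rewrite linear_sum; apply: eq_bigr => i _; rewrite linearZ /= (pvm_subr pvmE) //.
have nx : rnorm x <= 2 / d * rnorm y.
  apply: (pvm_step_le hilbertH pvmE) => //; first by rewrite divr_ge0 // ltW.
  move=> i /wJ wd; rewrite rnormV -invf_div lef_pV2 ?posrE //; lra.
have [dx fAx] := trunc_op Tx.
have := integral_step hilbertH closedS pvmE diagE DP x (ltW e0) st.
have sx : \sum_i w i *: E (T n `&` J i) x - l *: x = z.
  have -> : z = \sum_i E (T n `&` J i) y.
    by rewrite /z -[in LHS](step_cover st) (pvm_bigcup pvmE).
  rewrite -{2}Tx (step_sub closedS pvmE _ _ st).
  apply: eq_bigr => i _; rewrite Ex scalerA.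
  have [->|Ey] := eqVneq (E (T n `&` J i) y) 0; first by rewrite scaler0.
  rewrite mulfV ?scale1r // ; apply/eqP => wl; have := wJ i y Ey.
  by rewrite wl rnorm0; lra.
move: sx; set s := \sum_i w i *: _ => sx Ds.
(* Since <z,y> = |z|^2, orthogonality leaves |z|^2 = -<D_n(x) - s, y>, which is only the
   approximation error. *)
have := orth x dx; rewrite fAx (_ : D n x - l *: x = z + (D n x - s)); last first.
  by rewrite -sx [RHS]addrC subrKA.
rewrite ripDl /z -(pvm_rnorm_sqr hilbertH pvmE) // => h.
have := rip_le hilbertH (D n x - s) y; rewrite ler_norml => /andP[h1 h2].
have : rnorm (D n x - s) * rnorm y <= e * c.
  rewrite /c expr2 !mulrA ler_wpM2r ?rnorm_ge0 //; apply: le_trans Ds _.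
  by rewrite -!mulrA; apply: (ler_wpM2l (ltW e0)); rewrite mulrA.
by rewrite /z; lra.
Qed.

Lemma away_resolvent : resolvent_set fA l.
Proof.
apply: (resolvent_of_bounded_below hilbertH (d := d / 2)).
- by rewrite divr_gt0.
- exact: (fcalc_closed_graph hilbertH closedS pvmE diagE fR DP fAdom fAtrunc).
- exact: fcalc_bounded_below.
- exact: fcalc_range_dense.
Qed.

End Resolvent.

Lemma spectrum_value_set : spectrum fA = closure value_set.
Proof.
apply/seteqP; split; last exact: closure_value_set_spectrum.
move=> l sl; apply: contrapT => ncl; apply: sl.
have [e e0 le] : exists2 e : F, 0 < e & ball l e `&` value_set = set0.
  apply: contrapT => no; apply: ncl => U /nbhs_ballP[e /= e0 eU].
  apply: contrapT => UW; apply: no; exists e => //; apply/seteqP; split => // w [lw Ww].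
  by apply: UW; exists w; split => //; exact: eU.
have eE := ger0_of_real (ltW e0).
apply: (@away_resolvent l (real_part k e)); first by rewrite -(@of_real_lt R k) eE of_real0.
move=> w Ww; rewrite leNgt; apply/negP => wl.
suff : (ball l e `&` value_set) w by rewrite le.
by split => //; rewrite -ball_normE /= -eE -rnorm_lt rnormBC.
Qed.

End SpectralMapping.

(** * Deriving the two facts on [D n x] from the definition of f(A) *)

Section Bridge.
Context {R : realType} {k : scalar_kind}.
Local Notation F := (scalar_field R k).
Local Notation "a %:F" := (of_real k a).
Context {H : completeNormedModType F} (ip : {dot H for scalar_conj R k}).
Hypothesis hilbertH : is_hilbert ip.
Context (A : operator H) (saA : self_adjoint ip A).
Context (E : set R -> {linear H -> H}) (EA : spectral_measure_of ip A E).
Local Notation S := (rspectrum A).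
Context (f : R -> F) (fR : regulated S f).
Local Notation T := (truncation S).
Let closedS : closed S := rspectrum_closed hilbertH saA.
Let mS : measurable S := closed_measurable closedS.
Let bT n : borel_in S (T n) := borel_in_truncation mS n.
Let pvmE := EA.1.
Let diagE := spectral_diag EA.
Context (D : nat -> H -> H) (DP : forall n x, vector_integral E (T n) x f (D n x)).
Context (fA : operator H) (fAE : is_fcalc ip A E f fA).

Lemma rip_eq x y : (forall z, ip x z = ip y z) -> x = y.
Proof.
move=> xy; apply/eqP; rewrite -subr_eq0; apply/eqP.
by apply: (rip_orthogonal_eq0 hilbertH) => z; rewrite ripBl /rip xy subrr.
Qed.

Lemma bounded_fcalcE n : bounded_operator A -> S `<=` `[- n%:R, n%:R]%classic ->
  forall x, fA x = D n x.
Proof.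
move=> bA Sn x; have TS : T n = S by exact/setIidl.
have [[_ fAx] _] := (fAE.1 bA, tt).
apply: rip_eq => y; apply: (HK_integral_unique closedS (n := n)).
  by rewrite TS; exact: fAx.
exact: (vector_integral_HK hilbertH y (bT n) (DP n x)).
Qed.

Lemma integral_trunc_min n m x : E (T n) (D m x) = D (minn n m) x.
Proof.
rewrite -(integral_pvm hilbertH closedS pvmE DP) //.
have [nm|mn] := leqP n m.
  exact: (integral_truncation hilbertH closedS pvmE diagE fR DP).
rewrite -(integral_truncation hilbertH closedS pvmE diagE fR DP x (leqnn m)).
rewrite -[in LHS](integral_truncation hilbertH closedS pvmE diagE fR DP _ (leqnn m)).
by rewrite (pvm_subl pvmE) //; exact/truncationS/ltnW.
Qed.

(** When A is unbounded, the truncated integrals of |f|^2 are the numbers |D_n(x)|^2. They increase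
    with n because D_n(x) = E(T_n) D_m(x) for n <= m, so boundedness gives convergence. *)
Lemma fcalc_dom x : (exists M, forall n, rnorm (D n x) <= M) -> dom fA x.
Proof.
move=> [M DM]; have [bA|nbA] := pselect (bounded_operator A).
  by have [[-> _] _] := fAE.1 bA.
have [-> _] := fAE.2 nbA.
exists (fun n => (rnorm (D n x) ^+ 2)%:F).
  by move=> n; exact: (vector_integral_HK_sqr hilbertH pvmE (bT n) (DP n x)).
have mono : {homo (fun n => rnorm (D n x) ^+ 2) : n m / (n <= m)%N >-> n <= m}.
  move=> n m nm; rewrite ler_sqr ?nnegrE ?rnorm_ge0 //.
  rewrite -(minn_idPl nm) -integral_trunc_min; exact: (pvm_rnorm_le hilbertH pvmE).
have cvgD : cvgn (fun n => rnorm (D n x) ^+ 2).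
  apply: nondecreasing_is_cvgn => //; exists (M ^+ 2) => _ [n _ <-].
  by rewrite ler_sqr ?nnegrE ?rnorm_ge0 // (le_trans (rnorm_ge0 _) (DM n)).
apply/cvg_ex; exists (limn (fun n => rnorm (D n x) ^+ 2))%:F.
apply/cvg_rnormP => e e0; have /cvgrPdist_lt/(_ e e0) := cvgD.
by apply: filterS => n; rewrite -of_realB rnorm_real distrC.
Qed.

Lemma fcalc_trunc x n : dom fA x -> E (T n) (fA x) = D n x.
Proof.
move=> dx; have [bA|nbA] := pselect (bounded_operator A).
  have [m Sm] := bounded_rspectrum hilbertH saA EA bA.
  rewrite (bounded_fcalcE bA Sm) integral_trunc_min.
  have [nm //|mn] := leqP n m.
  (* Beyond m the truncations no longer change, so D_n = D_m. *)
  have TS p : (m <= p)%N -> T p = S.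
    move=> mp; apply/seteqP; split => [t []//|t St].
    by apply: (truncationS mp); split => //; exact: Sm.
  rewrite -(integral_truncation hilbertH closedS pvmE diagE fR DP x (ltnW mn)).
  by rewrite TS // (pvm_total pvmE).
have [_ fAx] := fAE.2 nbA; apply: rip_eq => y.
rewrite (pvm_projection pvmE (bT n).1 (bT n).2).2.
(* Tested against E(T_n)y, the truncated integrals equal <D_n(x),y> for all m >= n, so their limit
   is known. *)
have [u uHK ucvg] := fAx x (E (T n) y) dx.
rewrite -(cvg_lim _ ucvg) //; apply: cvg_lim => //; apply: cvg_near_cst.
exists n => // m /= nm.
rewrite (HK_integral_unique closedS (uHK m) (vector_integral_HK hilbertH _ (bT m) (DP m x))).
by rewrite -(pvm_projection pvmE (bT n).1 (bT n).2).2 integral_trunc_min (minn_idPl nm).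
Qed.

End Bridge.

Theorem theorem7p1 (R : realType) (k : scalar_kind)
    (H : completeNormedModType (scalar_field R k)) (ip : {dot H for scalar_conj R k})
    (hilbertH : is_hilbert ip)
    (A : operator H) (saA : self_adjoint ip A)
    (E : set R -> {linear H -> H}) (EA : spectral_measure_of ip A E)
    (f : R -> scalar_field R k) (fReg : regulated (rspectrum A) f)
    (fA : operator H) (fAE : is_fcalc ip A E f fA) :
  spectrum fA =
  closure ((f @` rpoint_spectrum A) `|`
           one_sided_limits (rspectrum A)
             (rspectrum A `\` rpoint_spectrum A) f).
Proof.
have closedS := rspectrum_closed hilbertH saA.
have /choice[D' D'P] (nx : nat * H) := regulated_vector_integral hilbertH closedS EA.1
  (spectral_diag EA) fReg nx.1 nx.2.
pose D n x := D' (n, x).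
have DP n x : vector_integral E (truncation (rspectrum A) n) x f (D n x) := D'P (n, x).
apply: (spectrum_value_set hilbertH saA EA fReg DP).
- exact: (fcalc_dom hilbertH saA EA fReg DP fAE).
- by move=> x n; exact: (fcalc_trunc hilbertH saA EA fReg DP fAE).
Qed.
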